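(* Let $(W,S)$ be a Coxeter system, $R$ a fusion ring with basis $\mathfrak B$, and $R\Lambda_S$ a geometric $R$-realisation of $(W,S)$. Let $\Theta=\mathrm{Hom}_R(R\Lambda_S,\mathbb R)\subseteq\check\Theta=\mathrm{Hom}_{\mathbb Z}(R\Lambda_S,\mathbb R)$, let $(T^\circ,\mathcal A)$ be the Tits cone and hyperplane system of $W$ acting on $\Theta$, and let $(\check T^\circ,\check{\mathcal A})$ be the Tits cone and hyperplane system of the unfolded Coxeter group $\check W$ acting on $\check\Theta$. Then $$\mathcal A=\{\check H\cap\Theta \mid \check H\in\check{\mathcal A},\ \check H\cap T^\circ\neq\emptyset\}.$$ Moreover, $T^\circ\subseteq\check T^\circ$, and so the inclusion $\Theta\subseteq\check\Theta$ restricts to an embedding of hyperplane complements $$T^\circ\setminus\bigcup_{H\in\mathcal A}H\ \subseteq\ \check T^\circ\setminus\bigcup_{\check H\in\check{\mathcal A}}\check H .$$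
   Context: Coxeter systems: $S$ is a finite set, $(m_{s,t})_{s,t\in S}$ is a symmetric matrix with $m_{s,s}=1$ and $m_{s,t}\in\{2,3,\dots,\infty\}$ for $s\ne t$, and $W=\langle S\mid (st)^{m_{s,t}}=1 \text{ whenever } m_{s,t}<\infty\rangle$. Rings are unital and associative, not necessarily commutative. Fusion ring: a ring $R$, free as a $\mathbb Z$-module on a finite basis $\mathfrak B=\{b_1,\dots,b_n\}$ with $b_1=1$, such that every product $b_jb_k=\sum_i {}_jc_{k,i}b_i$ is non-zero with all ${}_jc_{k,i}\in\mathbb Z_{\ge0}$, together with an involution $b_j\mapsto b_j^*=b_{j^*}$ of $\mathfrak B$ whose $\mathbb Z$-linear extension $*:R\to R$ satisfies $(rs)^*=s^*r^*$, and such that the coefficient of $1$ in $b_jb_k$ is $1$ if $k=j^*$ and $0$ otherwise. $R_{\ge0}$ is the set of non-negative integral combinations of $\mathfrak B$. $\mathrm{FPdim}(b_j)$ is the largest non-negative real (Frobenius–Perron) eigenvalue of the matrix $({}_jc_{k,\ell})_{k,\ell}$; extended $\mathbb Z$-linearly, $\mathrm{FPdim}:R\to\mathbb R$ is a ring homomorphism (the unique one non-negative on $\mathfrak B$), with $\mathrm{FPdim}(b)\ge1$ for $b\in\mathfrak B$ and $\mathrm{FPdim}(r^* )=\mathrm{FPdim}(r)$. Geometric $R$-realisation: $R\Lambda_S=\bigoplus_{s\in S}R\alpha_s$ is the free left $R$-module, with a $\mathbb Z$-bilinear form $B_R:R\Lambda_S\times R\Lambda_S\to R$ such that $B_R(x\alpha_s,y\alpha_t)=y\,r_{s,t}\,x^*$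 where $r_{s,t}=B_R(\alpha_s,\alpha_t)$ and $r_{s,s}=2$, such that $s(v)=v-B_R(\alpha_s,v)\alpha_s$ ($s\in S$) induces a well-defined left $R$-linear action of $W$ on $R\Lambda_S$; and, for $s\ne t$: $-r_{s,t}\in R_{\ge0}$, $r_{t,s}=r_{s,t}^*$, $\mathrm{FPdim}(r_{s,t})=-2\cos(\pi/m_{s,t})$ if $m_{s,t}<\infty$, and $\mathrm{FPdim}(r_{s,t})\le-2$ if $m_{s,t}=\infty$. Unfolded Coxeter system $(\check W,\check S)$: $\check S=\mathfrak B\times S$. For $(b_i,s),(b_j,t)\in\check S$ define integers $\check r_{(b_i,s),(b_j,t)}$ by: $2$ if $(b_i,s)=(b_j,t)$, $0$ if $s=t$ and $i\ne j$, and for $s\neq t$ by $b_j r_{s,t}=\sum_i \check r_{(b_i,s),(b_j,t)}b_i$. Distinct vertices are joined by an edge of the Coxeter graph iff $\check r\ne0$; the label is $3$ if $\check r=-1$ and $\infty$ if $\check r\le-2$ (no edge means $m=2$). $\mathbb Z\Lambda_{\check S}=\bigoplus_{(b,s)}\mathbb Z\alpha_{b,s}$ carries the symmetric form $B_{\mathbb Z}$ with matrix $\check r$, and $\check W$ acts by $(b,s)(v)=v-B_{\mathbb Z}(\alpha_{b,s},v)\alpha_{b,s}$. $\mathbb Z\Lambda_{\check S}$ is identified with $R\Lambda_S$ via $\alpha_{b,s}\leftrightarrow b\alpha_s$, so $\check W$ acts on $R\Lambda_S$ $\mathbb Z$-linearly. Dual spaces: $\mathbb R$ is a left $R$-module via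 $\mathrm{FPdim}$. $\Theta=\mathrm{Hom}_R(R\Lambda_S,\mathbb R)$ and $\check\Theta=\mathrm{Hom}_{\mathbb Z}(R\Lambda_S,\mathbb R)$, with contragredient actions $(w\cdot Z)(v)=Z(w^{-1}v)$ of $W$ on $\Theta$ and of $\check W$ on $\check\Theta$. Let $C=\{Z\in\Theta: Z(\alpha_s)\ge0\ \forall s\in S\}$ and $\check C=\{Z\in\check\Theta: Z(b\alpha_s)\ge0\ \forall b\in\mathfrak B,s\in S\}$. Both actions are actions as real reflection groups in the sense of Vinberg, with (closed) fundamental chambers $C$ and $\check C$. $T=\bigcup_{w\in W}w\cdot C$, and $T^\circ$ (interior in $\Theta$) is the Tits cone; $\mathcal A$ is the set of fixed hyperplanes in $\Theta$ of the elements $wsw^{-1}$ ($w\in W$, $s\in S$). $\check T$, $\check T^\circ$ (interior in $\check\Theta$) and $\check{\mathcal A}$ are defined in the same way from $\check W$, $\check S$, $\check C$, $\check\Theta$. *)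

(* Defs.v *)
From HB Require Import structures.
From mathcomp Require Import all_boot all_order all_algebra.
From mathcomp Require Import all_classical all_reals all_analysis.
From mathcomp Require Import generic_quotient.
From mathcomp Require Import ring.
Import Order.TTheory GRing.Theory Num.Theory.
Import numFieldNormedType.Exports.
Set Implicit Arguments.
Unset Strict Implicit.
Unset Printing Implicit Defensive.

Local Open Scope classical_set_scope.
Local Open Scope quotient_scope.
Local Open Scope ring_scope.

(* [None] encodes the label infinity. *)
Record coxeterMatrix (S : finType) := CoxeterMatrix {
  cox_label :> S -> S -> option nat;
  cox_diag : forall s, cox_label s s = Some 1%N;
  cox_sym : forall s t, cox_label s t = cox_label t s;
  cox_off : forall s t k, s != t -> cox_label s t = Some k -> (2 <= k)%N }.

Definition alternating (S : Type) (k : nat) (s t : S) : seq S :=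
  flatten (nseq k [:: s; t]).

(* The congruence on words generated by (s t)^m(s,t) = 1.  Formal inverses of
   the generators are not needed: m(s,s) = 1 yields s s = 1. *)
Inductive cox_equiv (S : finType) (M : coxeterMatrix S) :
    seq S -> seq S -> Prop :=
| cox_rel u v s t k :
    M s t = Some k -> cox_equiv M (u ++ alternating k s t ++ v) (u ++ v)
| cox_refl u : cox_equiv M u u
| cox_symm u v : cox_equiv M u v -> cox_equiv M v u
| cox_trans u v w : cox_equiv M u v -> cox_equiv M v w -> cox_equiv M u w.

Section CoxeterGroup.
Variables (S : finType) (M : coxeterMatrix S).

Definition cox_equivb (u v : seq S) : bool := `[< cox_equiv M u v >].

Fact cox_equivb_equiv : equiv_class_of cox_equivb.
Proof.
split=> [u|u v|v u w].
- exact/asboolP/cox_refl.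
- by apply/asboolP/asboolP => ?; exact: cox_symm.
- by move=> /asboolP uv /asboolP vw; exact/asboolP/(cox_trans uv vw).
Qed.

Canonical cox_equivb_rel := EquivRelPack cox_equivb_equiv.

Definition coxgroup := {eq_quot cox_equivb}.

HB.instance Definition _ := Choice.on coxgroup.
HB.instance Definition _ := EqQuotient.on coxgroup.

Lemma cox_piP (u v : seq S) :
  (\pi_coxgroup u = \pi_coxgroup v) <-> cox_equiv M u v.
Proof.
by split=> [/eqP|uv]; [rewrite eqmodE => /asboolP|apply/eqP; rewrite eqmodE; apply/asboolP].
Qed.

Lemma cox_reprP (u : seq S) : cox_equiv M (repr (\pi_coxgroup u)) u.
Proof. by apply/cox_piP; rewrite reprK. Qed.

Lemma cox_equiv_ctx a b u v :
  cox_equiv M u v -> cox_equiv M (a ++ u ++ b) (a ++ v ++ b).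
Proof.
elim=> {u v} [u v s t k Mst|u|u v _|u v w _ uv _ vw].
- by have := cox_rel (a ++ u) (v ++ b) Mst; rewrite !catA.
- exact: cox_refl.
- exact: cox_symm.
- exact: cox_trans uv vw.
Qed.

Lemma cox_equiv_cat u v u' v' :
  cox_equiv M u u' -> cox_equiv M v v' -> cox_equiv M (u ++ v) (u' ++ v').
Proof.
move=> /(cox_equiv_ctx [::] v) /= uu' /(cox_equiv_ctx u' [::]).
by rewrite !cats0; exact: cox_trans.
Qed.

Lemma cox_equiv_rev_cat u : cox_equiv M (rev u ++ u) [::].
Proof.
elim: u => [|s u IHu]; first exact: cox_refl.
rewrite rev_cons cat_rcons; apply: cox_trans IHu.
by have := cox_rel (rev u) u (cox_diag M s).
Qed.

Lemma cox_equiv_cat_rev u : cox_equiv M (u ++ rev u) [::].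
Proof. by rewrite -{1}[u]revK; exact: cox_equiv_rev_cat. Qed.

Definition cox_one : coxgroup := \pi_coxgroup [::].
Definition cox_mul (x y : coxgroup) : coxgroup := \pi_coxgroup (repr x ++ repr y).
Definition cox_inv (x : coxgroup) : coxgroup := \pi_coxgroup (rev (repr x)).

Fact cox_mulA : associative cox_mul.
Proof.
move=> x y z; apply/cox_piP.
apply: (cox_trans (cox_equiv_cat (cox_refl _ _) (cox_reprP _))).
rewrite catA; apply: cox_symm.
exact: cox_equiv_cat (cox_reprP _) (cox_refl _ _).
Qed.

Fact cox_mul1 : left_id cox_one cox_mul.
Proof.
move=> x; rewrite -[RHS]reprK; apply/cox_piP.
exact: (cox_equiv_cat (cox_reprP _) (cox_refl _ _)).
Qed.

Fact cox_1mul : right_id cox_one cox_mul.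
Proof.
move=> x; rewrite -[RHS]reprK; apply/cox_piP.
by have := cox_equiv_cat (cox_refl M (repr x)) (cox_reprP [::]); rewrite cats0.
Qed.

Fact cox_mulV : left_inverse cox_one cox_inv cox_mul.
Proof.
move=> x; apply/cox_piP; apply: cox_trans (cox_equiv_rev_cat (repr x)).
exact: cox_equiv_cat (cox_reprP _) (cox_refl _ _).
Qed.

Fact cox_Vmul : right_inverse cox_one cox_inv cox_mul.
Proof.
move=> x; apply/cox_piP; apply: cox_trans (cox_equiv_cat_rev (repr x)).
exact: cox_equiv_cat (cox_refl _ _) (cox_reprP _).
Qed.

HB.instance Definition _ :=
  isGroup.Build coxgroup cox_mulA cox_mul1 cox_1mul cox_mulV cox_Vmul.

Definition cox_gen (s : S) : coxgroup := \pi_coxgroup [:: s].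

End CoxeterGroup.

Definition is_action (G : groupType) (V : Type) (act : G -> V -> V) : Prop :=
  (forall v, act 1%g v = v) /\
  (forall g h v, act (g * h)%g v = act g (act h v)).

Section CoxeterAction.
Variables (S : finType) (M : coxeterMatrix S) (V : Type) (f : S -> V -> V).

Definition word_act (u : seq S) (v : V) : V := foldr f v u.

(* A genuine action as soon as [f] satisfies the defining relations of the
   group, see [cox_act_is_action] and [cox_act_gen]. *)
Definition cox_act (w : coxgroup M) : V -> V := word_act (repr w).

Hypothesis f_rel : forall s t k, M s t = Some k ->
  forall v, iter k (f s \o f t) v = v.

Lemma word_act_equiv u u' : cox_equiv M u u' -> word_act u =1 word_act u'.
Proof.
elim=> {u u'} [u w s t k Mst|u|u w _ uw|u x w _ ux _ xw] v //.
- rewrite /word_act !foldr_cat; congr foldr.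
  rewrite -[RHS](f_rel Mst) /alternating.
  by elim: k {Mst} => [//|k IHk] /=; rewrite IHk.
- by rewrite ux xw.
Qed.

Lemma cox_act_is_action : is_action cox_act.
Proof.
split=> [v|g h v]; rewrite /cox_act.
  by rewrite (word_act_equiv (cox_reprP M [::])).
by rewrite (word_act_equiv (cox_reprP M _)) /word_act foldr_cat.
Qed.

Lemma cox_act_gen s : cox_act (cox_gen M s) =1 f s.
Proof. by move=> v; rewrite /cox_act (word_act_equiv (cox_reprP M _)). Qed.

End CoxeterAction.

Record fusionRing := FusionRing {
  fr_ring :> nzRingType;
  fr_rank1 : nat;
  fr_basis : 'I_fr_rank1.+1 -> fr_ring;
  fr_coef : fr_ring -> 'I_fr_rank1.+1 -> int;
  fr_dual : 'I_fr_rank1.+1 -> 'I_fr_rank1.+1;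
  (* freeness: [fr_coef] gives the coordinates in [fr_basis] *)
  fr_coefK : forall x, \sum_i fr_basis i *~ fr_coef x i = x;
  fr_basisK : forall (c : 'I_fr_rank1.+1 -> int) i,
    fr_coef (\sum_k fr_basis k *~ c k) i = c i;
  fr_basis1 : fr_basis ord0 = 1;
  fr_mul_neq0 : forall j k, fr_basis j * fr_basis k != 0;
  fr_mul_ge0 : forall j k i, 0 <= fr_coef (fr_basis j * fr_basis k) i;
  fr_dualK : involutive fr_dual;
  fr_starM :
    let star x := \sum_i fr_basis (fr_dual i) *~ fr_coef x i in
    forall x y, star (x * y) = star y * star x;
  fr_trace : forall j k,
    fr_coef (fr_basis j * fr_basis k) ord0 = (k == fr_dual j)%:R }.

Notation fr_index R := 'I_(fr_rank1 R).+1.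

Section FusionRing.
Variable R : fusionRing.
Implicit Types (x y : R) (i j k : fr_index R).

Definition fr_star x : R := \sum_i fr_basis (fr_dual i) *~ fr_coef x i.

Definition fr_nneg x : Prop := forall i, 0 <= fr_coef x i.

Variable K : realType.

Definition fr_mulmx j : 'M[K]_((fr_rank1 R).+1) :=
  \matrix_(k, l) (fr_coef (fr_basis j * fr_basis k) l)%:~R.

(* [eigenvalue] refers to row vectors; a matrix and its transpose have the same
   eigenvalues.  The supremum is over a finite set, which is non-empty by the
   Perron-Frobenius theorem, so it is a maximum. *)
Definition FPdim_basis j : K :=
  sup [set a : K | 0 <= a /\ eigenvalue (fr_mulmx j) a].

Definition FPdim x : K := \sum_i (fr_coef x i)%:~R * FPdim_basis i.

Lemma fr_coefD x y i : fr_coef (x + y) i = fr_coef x i + fr_coef y i.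
Proof.
rewrite -{1}[x]fr_coefK -{1}[y]fr_coefK -big_split /=.
under eq_bigr do rewrite -mulrzDr.
exact: fr_basisK.
Qed.

Lemma fr_coefMz x (n : int) i : fr_coef (x *~ n) i = fr_coef x i * n.
Proof.
rewrite -{1}[x]fr_coefK mulrz_suml.
under eq_bigr do rewrite -mulrzA.
exact: fr_basisK.
Qed.

Lemma fr_coef0 i : fr_coef (0 : R) i = 0.
Proof. by rewrite -(mulr0z (0 : R)) fr_coefMz mulr0. Qed.

Lemma fr_coef_sum (I : finType) (F : I -> R) i :
  fr_coef (\sum_a F a) i = \sum_a fr_coef (F a) i.
Proof.
by apply: (big_morph (fun x => fr_coef x i)) => [x y|];
  rewrite ?fr_coefD ?fr_coef0.
Qed.

Lemma fr_coef_basis j i : fr_coef (fr_basis j : R) i = (i == j)%:R.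
Proof.
rewrite -(fr_basisK (fun l => (l == j)%:R)); congr fr_coef.
rewrite (bigD1 j) //= eqxx big1 ?addr0 // => l /negPf ->.
by rewrite mulr0z.
Qed.

Lemma fr_coef_star x i : fr_coef (fr_star x) i = fr_coef x (fr_dual i).
Proof.
rewrite /fr_star (reindex_inj (inv_inj (@fr_dualK R))) /=.
under eq_bigr do rewrite fr_dualK.
exact: fr_basisK.
Qed.

Lemma fr_dual0 : fr_dual (ord0 : fr_index R) = ord0.
Proof.
have := fr_trace (ord0 : fr_index R) ord0.
by rewrite fr_basis1 mul1r -(@fr_basis1 R) fr_coef_basis eqxx; case: eqP.
Qed.

Lemma fr_star_mul x y : fr_star (x * y) = fr_star y * fr_star x.
Proof. exact: fr_starM. Qed.

Lemma fr_star_basis j : fr_star (fr_basis j) = fr_basis (fr_dual j).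
Proof.
rewrite /fr_star (bigD1 j) //= fr_coef_basis eqxx big1 ?addr0 // => l /negPf lj.
by rewrite fr_coef_basis lj mulr0z.
Qed.

Lemma fr_coef0_dual j x :
  fr_coef (fr_basis (fr_dual j) * x) ord0 = fr_coef x j.
Proof.
rewrite -{1}[x]fr_coefK mulr_sumr fr_coef_sum (bigD1 j) //=.
rewrite big1 ?addr0 => [|l /negPf lj].
  by rewrite mulrzAr fr_coefMz fr_trace fr_dualK eqxx mul1r.
by rewrite mulrzAr fr_coefMz fr_trace fr_dualK lj mul0r.
Qed.

Lemma fr_coef0C x y : fr_coef (x * y) ord0 = fr_coef (y * x) ord0.
Proof.
rewrite -[x]fr_coefK -[y]fr_coefK !mulr_suml !fr_coef_sum.
under eq_bigr do rewrite mulr_sumr fr_coef_sum.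
under [RHS]eq_bigr do rewrite mulr_sumr fr_coef_sum.
rewrite exchange_big /=; apply: eq_bigr => j _; apply: eq_bigr => i _.
rewrite !mulrzAl !mulrzAr !fr_coefMz !fr_trace mulrAC; congr (_ * _ * _).
by congr (nat_of_bool _)%:R; rewrite -(inj_eq (inv_inj (@fr_dualK R))) fr_dualK eq_sym.
Qed.

Lemma fr_coef_mul_star x i j :
  fr_coef (fr_basis j * x) i = fr_coef (fr_basis i * fr_star x) j.
Proof.
rewrite -[LHS]fr_coef0_dual -[in LHS]fr_dual0 -fr_coef_star.
rewrite !fr_star_mul !fr_star_basis fr_dualK.
by rewrite -mulrA fr_coef0C -mulrA fr_coef0_dual.
Qed.

End FusionRing.

Definition fr_lattice (S : finType) (R : fusionRing) := {ffun S -> R^o}.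

Definition simple_root (S : finType) (R : fusionRing) (s : S) :
  fr_lattice S R := [ffun t => (t == s)%:R].

Record realisation (K : realType) (S : finType) (M : coxeterMatrix S)
    (R : fusionRing) := Realisation {
  rl_form : fr_lattice S R -> fr_lattice S R -> R;
  rl_act : coxgroup M -> fr_lattice S R -> fr_lattice S R;
  rl_formDl : forall u v w : fr_lattice S R,
    rl_form (u + v) w = rl_form u w + rl_form v w;
  rl_formDr : forall u v w : fr_lattice S R,
    rl_form u (v + w) = rl_form u v + rl_form u w;
  rl_form_simple : forall (x y : R) (s t : S),
    rl_form (x *: simple_root R s) (y *: simple_root R t) =
    y * rl_form (simple_root R s) (simple_root R t) * fr_star x;
  rl_form_diag : forall s,
    rl_form (simple_root R s) (simple_root R s) = 2%:R;
  rl_act_action : is_action rl_act;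
  rl_act_linear : forall w, linear (rl_act w);
  rl_act_gen : forall s v,
    rl_act (cox_gen M s) v =
    v - rl_form (simple_root R s) v *: simple_root R s;
  rl_form_nneg : forall s t, s != t ->
    fr_nneg (- rl_form (simple_root R s) (simple_root R t));
  rl_form_star : forall s t, s != t ->
    rl_form (simple_root R t) (simple_root R s) =
    fr_star (rl_form (simple_root R s) (simple_root R t));
  rl_form_fin : forall s t k, s != t -> M s t = Some k ->
    FPdim K (rl_form (simple_root R s) (simple_root R t)) =
    - 2 * cos (trigo.pi / k%:R);
  rl_form_inf : forall s t, s != t -> M s t = None ->
    FPdim K (rl_form (simple_root R s) (simple_root R t)) <= - 2 }.

Section Unfolding.
Variables (K : realType) (S : finType) (M : coxeterMatrix S) (R : fusionRing).
Variable L : realisation K M R.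

Notation unf_index := (fr_index R * S)%type.
Notation lattice := (fr_lattice S R).

Definition unf_root (p : unf_index) : lattice :=
  (fr_basis p.1 : R) *: simple_root R p.2.

Definition unf_entry (p q : unf_index) : int :=
  if p == q then 2
  else if p.2 == q.2 then 0
  else fr_coef (fr_basis q.1 *
                rl_form L (simple_root R p.2) (simple_root R q.2)) p.1.

Definition unf_label (p q : unf_index) : option nat :=
  if p == q then Some 1%N
  else if unf_entry p q == 0 then Some 2%N
  else if unf_entry p q == -1 then Some 3%N
  else None.

Lemma unf_entry_sym p q : unf_entry p q = unf_entry q p.
Proof.
rewrite /unf_entry [q == p]eq_sym [q.2 == p.2]eq_sym.
case: eqP => // _; case: (eqVneq p.2 q.2) => // pq.
by rewrite (rl_form_star L pq) fr_coef_mul_star.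
Qed.

Fact unf_label_diag p : unf_label p p = Some 1%N.
Proof. by rewrite /unf_label eqxx. Qed.

Fact unf_label_sym p q : unf_label p q = unf_label q p.
Proof. by rewrite /unf_label unf_entry_sym eq_sym. Qed.

Fact unf_label_off p q k : p != q -> unf_label p q = Some k -> (2 <= k)%N.
Proof.
by rewrite /unf_label => /negPf ->; do 2?[case: ifP => _]; [case=> <-..|].
Qed.

Definition unf_matrix : coxeterMatrix unf_index :=
  CoxeterMatrix unf_label_diag unf_label_sym unf_label_off.

Definition unf_coord (p : unf_index) (v : lattice) : int :=
  fr_coef (v p.2 : R) p.1.

Definition unf_form (u v : lattice) : int :=
  \sum_p \sum_q unf_coord p u * unf_coord q v * unf_entry p q.

Definition unf_refl (p : unf_index) (v : lattice) : lattice :=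
  v - unf_root p *~ unf_form (unf_root p) v.

Definition unf_act : coxgroup unf_matrix -> lattice -> lattice :=
  cox_act unf_refl.

Lemma unf_coordD p u v : unf_coord p (u + v) = unf_coord p u + unf_coord p v.
Proof. by rewrite /unf_coord ffunE fr_coefD. Qed.

Lemma unf_coordMz p u (n : int) : unf_coord p (u *~ n) = unf_coord p u * n.
Proof.
rewrite /unf_coord -fr_coefMz; congr fr_coef.
case: n => n; first by rewrite -!pmulrn ffunMnE.
by rewrite NegzE !mulrNz -!pmulrn ffunE ffunMnE.
Qed.

Lemma unf_coord_root p q : unf_coord p (unf_root q) = (p == q)%:R.
Proof.
rewrite /unf_coord /unf_root !ffunE /= [_ *: _]mulr_natr.
rewrite -mulrz_nat fr_coefMz fr_coef_basis -pair_eqE /=.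
by case: eqP; case: eqP.
Qed.

Lemma unf_form_root p v :
  unf_form (unf_root p) v = \sum_q unf_coord q v * unf_entry p q.
Proof.
rewrite /unf_form (bigD1 p) //= [X in _ + X]big1 ?addr0 => [|i /negPf ip].
  by apply: eq_bigr => q _; rewrite unf_coord_root eqxx mul1r.
by apply: big1 => q _; rewrite unf_coord_root ip !mul0r.
Qed.

Lemma unf_form_rootD p u v :
  unf_form (unf_root p) (u + v) =
  unf_form (unf_root p) u + unf_form (unf_root p) v.
Proof.
rewrite !unf_form_root -big_split /=.
by apply: eq_bigr => q _; rewrite unf_coordD mulrDl.
Qed.

Lemma unf_form_rootMz p u (n : int) :
  unf_form (unf_root p) (u *~ n) = unf_form (unf_root p) u * n.
Proof.
rewrite !unf_form_root mulr_suml.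
by apply: eq_bigr => q _; rewrite unf_coordMz mulrAC.
Qed.

Lemma unf_form_roots p q : unf_form (unf_root p) (unf_root q) = unf_entry p q.
Proof.
rewrite unf_form_root (bigD1 q) //= unf_coord_root eqxx mul1r.
by rewrite big1 ?addr0 // => i /negPf iq; rewrite unf_coord_root iq mul0r.
Qed.

Lemma unf_form_refl p q v :
  unf_form (unf_root p) (unf_refl q v) =
  unf_form (unf_root p) v - unf_entry p q * unf_form (unf_root q) v.
Proof.
by rewrite unf_form_rootD -mulrNz unf_form_rootMz unf_form_roots mulrN.
Qed.

Lemma unf_refl_rel p q k : unf_matrix p q = Some k ->
  forall v, iter k (unf_refl p \o unf_refl q) v = v.
Proof.
move=> pqk v; set x := unf_form (unf_root p) v; set y := unf_form (unf_root q) v.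
pose e := unf_entry p q.
pose h (m n : int) := v - unf_root p *~ m - unf_root q *~ n.
have Ep i : unf_entry i i = 2 by rewrite /unf_entry eqxx.
have hE i m n : unf_form (unf_root i) (h m n) =
    unf_form (unf_root i) v - m * unf_entry i p - n * unf_entry i q.
  rewrite /h -!mulrNz !unf_form_rootD !unf_form_rootMz !unf_form_roots.
  by rewrite !mulrN ![unf_entry i _ * _]mulrC.
have hp m n : unf_refl p (h m n) = h (x - m - n * e) n.
  rewrite /unf_refl hE Ep /h -/x -/e addrAC.
  rewrite -[v - _ - _]addrA -[- _ - _]opprD -mulrzDr.
  by congr (_ - _ *~ _ - _); ring.
have hq m n : unf_refl q (h m n) = h m (y - n - m * e).
  rewrite /unf_refl hE Ep unf_entry_sym /h -/y -/e.
  rewrite -addrA -[- _ - _]opprD -mulrzDr.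
  by congr (_ - _ - _ *~ _); ring.
have h0 : v = h 0 0 by rewrite /h !mulr0z !subr0.
move: pqk; rewrite /= /unf_label; case: eqVneq => [pq [<-]|_ pqk].
  rewrite /= pq {1}/unf_refl unf_form_refl Ep /unf_refl -/y.
  rewrite -addrA -[- _ - _]opprD -mulrzDr (_ : y + _ = 0) ?mulr0z ?subr0 //; ring.
rewrite {2}h0 [X in iter _ _ X]h0; move: pqk.
case: eqP => [e0 [<-]|_]; last case: eqP => [e1 [<-]|_] //.
  by rewrite /= !(hp, hq) /e e0; congr h; ring.
by rewrite /= !(hp, hq) /e e1; congr h; ring.
Qed.

Lemma unf_act_is_action : is_action unf_act.
Proof. exact: cox_act_is_action unf_refl_rel. Qed.

Lemma unf_act_gen p : unf_act (cox_gen unf_matrix p) =1 unf_refl p.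
Proof. exact: (cox_act_gen unf_refl_rel). Qed.

End Unfolding.

Section TitsCone.
Variables (K : realType) (V : Type) (G : groupType) (I : Type).
Variables (act : G -> V -> V) (gen : I -> G).
Variables (Theta C : set (V -> K)).

Definition dual_act (w : G) (Z : V -> K) : V -> K := fun v => Z (act w^-1%g v).

Definition chamber_orbit : set (V -> K) := \bigcup_w (dual_act w @` C).

(* [Theta] carries the topology of pointwise convergence, which is its standard
   topology when it is a finite-dimensional space of homomorphisms. *)
Definition tits_cone : set (V -> K) :=
  Theta `&` @interior (subspace (Theta : set {ptws V -> K})) chamber_orbit.

Definition reflecting_hyperplanes : set (set (V -> K)) :=
  [set H | exists w i, H =
    [set Z | Theta Z /\ dual_act (w * gen i * w^-1)%g Z = Z]].

End TitsCone.

Section RealisationCones.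
Variables (K : realType) (S : finType) (M : coxeterMatrix S) (R : fusionRing).
Variable L : realisation K M R.

Definition rl_dual : set (fr_lattice S R -> K) :=
  [set Z | (forall u v, Z (u + v) = Z u + Z v) /\
           (forall (r : R) v, Z (r *: v) = FPdim K r * Z v)].

Definition rl_chamber : set (fr_lattice S R -> K) :=
  [set Z | rl_dual Z /\ forall s, 0 <= Z (simple_root R s)].

Definition rl_cone := tits_cone (rl_act L) rl_dual rl_chamber.

Definition rl_hyperplanes :=
  reflecting_hyperplanes (rl_act L) (cox_gen M) rl_dual.

Definition unf_dual : set (fr_lattice S R -> K) :=
  [set Z | forall u v, Z (u + v) = Z u + Z v].

Definition unf_chamber : set (fr_lattice S R -> K) :=
  [set Z | unf_dual Z /\
           forall (i : fr_index R) s, 0 <= Z (fr_basis i *: simple_root R s)].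

Definition unf_cone := tits_cone (@unf_act K S M R L) unf_dual unf_chamber.

Definition unf_hyperplanes :=
  reflecting_hyperplanes (@unf_act K S M R L) (cox_gen (unf_matrix L)) unf_dual.

Lemma rl_dual_sub : rl_dual `<=` unf_dual.
Proof. by move=> Z []. Qed.

End RealisationCones.

Arguments rl_dual K S R : clear implicits.
Arguments unf_dual K S R : clear implicits.

(* Main.v *)
(* Each simple reflection s of W acts as the product of the commuting reflections
   (b, s) of the unfolded group W', so every element of W acts as an element of
   W'.  As FPdim is a character of R that is positive on the basis, the chamber
   C lies in C', hence the orbit of C lies in that of C'.  Roots of W' are
   positive or negative, so Z lies in the orbit of C' iff it is negative on
   finitely many positive roots.  Let rho be the functional equal to 1 on all
   simple roots of W.  If Z is in the Tits cone of W then Z - e rho is still in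
   the orbit of C', and any Z' near Z dominates Z - e rho on positive roots, so Z
   is interior to the orbit of C'.
   For the hyperplanes, a root v of W' vanishing at a point of the Tits cone of W
   but not proportional on Theta to a root of W would also vanish at a point of
   the cone avoiding the countably many hyperplanes of W, i.e. at a translate of
   an interior point of C; there every root of W' is non-zero. *)
Require Import Defs.
From mathcomp Require Import all_boot all_order all_algebra.
From mathcomp Require Import all_classical all_reals all_analysis.
From mathcomp Require Import generic_quotient.
From mathcomp Require Import ring lra zify.
Import Order.TTheory GRing.Theory Num.Theory.
Import numFieldNormedType.Exports.
Set Implicit Arguments.
Unset Strict Implicit.
Unset Printing Implicit Defensive.

Local Open Scope classical_set_scope.
Local Open Scope quotient_scope.
Local Open Scope ring_scope.

(** * Perron vector of a positive symmetric matrix *)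

Section PerronSymmetric.
Variables (K : realType) (n : nat) (A : 'I_n.+1 -> 'I_n.+1 -> K).
Hypothesis A_sym : forall i j, A i j = A j i.
Hypothesis A_gt0 : forall i j, 0 < A i j.
Implicit Types x y : 'I_n.+1 -> K.

Let bil x y := \sum_i \sum_j A i j * x i * y j.
Let dot x y := \sum_i x i * y i.

Let bilC x y : bil x y = bil y x.
Proof.
rewrite /bil exchange_big; apply: eq_bigr => i _; apply: eq_bigr => j _.
by rewrite A_sym mulrAC.
Qed.

Let bilE x y : bil x y = \sum_i x i * \sum_j A i j * y j.
Proof.
apply: eq_bigr => i _; rewrite mulr_sumr; apply: eq_bigr => j _.
by rewrite mulrA [x i * _]mulrC.
Qed.

Let bil_quad x y t : bil (fun i => x i + t * y i) (fun i => x i + t * y i) =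
  bil x x + 2 * t * bil x y + t ^+ 2 * bil y y.
Proof.
have -> : 2 * t * bil x y = t * bil x y + t * bil y x by rewrite [bil y x]bilC; ring.
rewrite /bil !mulr_sumr -!big_split /=; apply: eq_bigr => i _.
rewrite !mulr_sumr -!big_split /=; apply: eq_bigr => j _; ring.
Qed.

Let dot_quad x y t : dot (fun i => x i + t * y i) (fun i => x i + t * y i) =
  dot x x + 2 * t * dot x y + t ^+ 2 * dot y y.
Proof.
rewrite /dot !mulr_sumr -!big_split /=; apply: eq_bigr => i _; ring.
Qed.

Let dot_ge0 x : 0 <= dot x x.
Proof. by apply: sumr_ge0 => i _; rewrite -expr2 sqr_ge0. Qed.

Let dot_eq0 x : dot x x = 0 -> forall i, x i = 0.
Proof.
move=> /eqP; rewrite psumr_eq0 => [/allP h i|i _]; last by rewrite -expr2 sqr_ge0.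
by have := h i (mem_index_enum _); rewrite -expr2 sqrf_eq0 => /eqP.
Qed.

(* The Rayleigh quotient attains its maximum on the compact unit sphere. *)
Let rayleigh_max : exists u, dot u u = 1 /\ forall x, bil x x <= bil u u * dot x x.
Proof.
pose co (v : 'rV[K]_n.+1) i : K := v ord0 i.
have cco i : continuous (fun v : 'rV[K]_n.+1 => v ord0 i).
  by move=> v; exact: coord_continuous.
have cF (F : 'I_n.+1 -> 'rV[K]_n.+1 -> K) : (forall i, continuous (F i)) ->
    continuous (fun v => \sum_i F i v).
  move=> cF v; rewrite (_ : (fun v => _) = \sum_i F i); last first.
    by apply/funext => w; rewrite fct_sumE.
  by apply: (big_ind (fun f : 'rV[K]_n.+1 -> K => {for v, continuous f})) => [|f g|i _];
    [exact: cst_continuous|exact: continuousD|exact: cF].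
pose B := [set v : 'rV[K]_n.+1 | dot (co v) (co v) = 1].
have cdot : continuous (fun v => dot (co v) (co v)).
  by apply: cF => i v; apply: continuousM; exact: cco.
have Bcpt : compact B.
  have boxK : compact [set v : 'rV[K]_n.+1 | forall i, `[-1, 1]%classic (v ord0 i)].
    apply: (@rV_compact K n.+1 (fun=> `[(-1 : K), 1]%classic)) => _; exact: segment_compact.
  apply: subclosed_compact boxK _.
  - rewrite (_ : B = (fun v => dot (co v) (co v)) @^-1` [set x | x = 1]) //.
    by apply: preimage_closed => [v _|]; [exact: cdot|exact: closed_eq].
  - move=> v Bv i /=; rewrite in_itv /= -ler_norml -(@expr_le1 _ 2) ?normr_ge0 //.
    rewrite real_normK ?num_real //.
    rewrite -Bv /dot (bigD1 i) //= expr2 lerDl.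
    by apply: sumr_ge0 => j _; rewrite -expr2 sqr_ge0.
have B0 : B !=set0.
  exists (delta_mx ord0 ord0); rewrite /B /= /dot /co (bigD1 ord0) //=.
  rewrite big1 ?addr0 ?mxE ?eqxx ?mulr1 // => i /negPf i0.
  by rewrite mxE i0 andbF mulr0.
have cbil : continuous (fun v => bil (co v) (co v)).
  apply: (cF) => i; apply: cF => j v.
  apply: (@continuousM K _ (fun v => A i j * co v i) (fun v => co v j)); last exact: cco.
  by apply: (@continuousM K _ (fun=> A i j) (fun v => co v i)); [exact: cst_continuous|exact: cco].
have [u uB umax] := EVT_max_rV B0 Bcpt (continuous_subspaceT cbil).
exists (co u); split; first by move: uB; rewrite inE.
move=> x; have [x0|] := eqVneq (dot x x) 0.
  rewrite x0 mulr0 /bil big1 // => i _; rewrite big1 // => j _.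
  by rewrite (dot_eq0 x0 j) mulr0.
move=> xn0; pose r := Num.sqrt (dot x x).
have r2 : r ^+ 2 = dot x x by rewrite sqr_sqrtr.
have rn0 : r != 0 by move: xn0; rewrite -r2 sqrf_eq0.
have xB : (\row_i (x i / r)) \in B.
  rewrite inE /B /= /dot /co; under eq_bigr do rewrite mxE.
  transitivity (r ^- 2 * dot x x); last by rewrite -r2 mulVf // sqrf_eq0.
  by rewrite mulr_sumr; apply: eq_bigr => i _; field.
have := umax _ xB; rewrite -ler_pdivrMr ?lt_def ?xn0 ?dot_ge0 //.
congr (_ <= _); rewrite -r2 /bil /co mulr_suml; apply: eq_bigr => i _.
by rewrite mulr_suml; apply: eq_bigr => j _; rewrite !mxE; field.
Qed.

(** As the entries of [A] are positive, the absolute value of a maximiser of the Rayleigh quotient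
    is again a maximiser. Maximality makes it an eigenvector; positivity of the entries makes it
    nowhere zero and its eigenspace one-dimensional. *)
Lemma perron_symmetric : exists l v, [/\ forall i, 0 < v i,
  forall i, \sum_j A i j * v j = l * v i &
  forall w, (forall i, \sum_j A i j * w j = l * w i) ->
    exists c, forall i, w i = c * v i].
Proof.
have [u [u1 umax]] := rayleigh_max; pose l := bil u u; pose v i := `|u i|.
have v1 : dot v v = 1.
  by rewrite -u1; apply: eq_bigr => i _; rewrite -normrM ger0_norm // -expr2 sqr_ge0.
have vl : bil v v = l.
  apply/eqP; rewrite eq_le -{1}[l]mulr1 -{1}v1 umax /= /l /bil.
  apply: ler_sum => i _; apply: ler_sum => j _.
  rewrite -!mulrA ler_pM2l ?A_gt0 // /v -normrM; exact: ler_norm.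
(* [g] is the defect of the eigenvalue equation; maximality along the line [v + t g] will force it
   to vanish. *)
pose g i := l * v i - \sum_j A i j * v j.
have gg : dot g g = l * dot v g - bil v g.
  rewrite bilC bilE /dot mulr_sumr -sumrB; apply: eq_bigr => i _; rewrite /g; ring.
have g0 : dot g g = 0.
  have G0 := dot_ge0 g; pose c := l * dot g g - bil g g.
  have c0 : 0 <= c by rewrite subr_ge0 umax.
  have q t : 0 <= 2 * t * dot g g + t ^+ 2 * c.
    have := umax (fun i => v i + t * g i); rewrite bil_quad dot_quad v1 vl -/l.
    have -> : bil v g = l * dot v g - dot g g by rewrite gg; ring.
    by rewrite -subr_ge0; congr (_ <= _); rewrite /c; ring.
  (* For a small negative [t] the linear term wins. The denominator is [c + 1] because [c] may be
     zero. *)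
  have := q (- dot g g / (c + 1)); have cp : 0 < c + 1 by lra.
  rewrite (_ : _ + _ = - (dot g g / (c + 1)) ^+ 2 * (c + 2)); last first.
    by field; lra.
  rewrite mulNr oppr_ge0 pmulr_lle0; last by lra.
  move=> h; have : (dot g g / (c + 1)) ^+ 2 == 0 by rewrite eq_le h sqr_ge0.
  by rewrite sqrf_eq0 mulf_eq0 invr_eq0 (gt_eqF cp) orbF => /eqP.
have Av i : \sum_j A i j * v j = l * v i.
  by have /eqP := dot_eq0 g0 i; rewrite subr_eq0 => /eqP.
(* Every row of [A] sees every coordinate, so a single non-positive coordinate of [A y] annihilates
   a non-negative [y]. *)
have pos y i : (forall j, 0 <= y j) -> (\sum_j A i j * y j <= 0) -> forall j, y j = 0.
  move=> y0 s0 j; apply/eqP; rewrite eq_le y0 andbT.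
  rewrite -(pmulr_rle0 _ (A_gt0 i j)); apply: le_trans s0.
  rewrite (bigD1 j) //= lerDl; apply: sumr_ge0 => k _.
  by rewrite mulr_ge0 // ltW.
have v0 i : 0 < v i.
  rewrite lt_def normr_ge0 andbT; apply/negP => /eqP vi0.
  have z : forall j, v j = 0 by apply: (pos v i) => [j|]; rewrite ?normr_ge0 // Av vi0 mulr0.
  by have := v1; rewrite /dot big1 => [/eqP|j _]; rewrite ?z ?mulr0 // eq_sym oner_eq0.
exists l, v; split=> // w Aw.
(* For [c] the least ratio [w i / v i], the vector [w - c v] is a non-negative eigenvector with a
   zero coordinate, so [pos] applies. *)
have [i _ imin] := @Order.TotalTheory.arg_minP _ K _ ord0 xpredT (fun i => w i / v i) isT.
exists (w i / v i) => j.
suff /(_ j)/eqP : forall j, w j - w i / v i * v j = 0 by rewrite subr_eq0 => /eqP.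
apply: (pos _ i) => [k|]; first by rewrite subr_ge0 -ler_pdivlMr ?imin.
under eq_bigr do rewrite mulrBr mulrCA.
rewrite sumrB -mulr_sumr Av Aw (_ : _ - _ = 0) //.
by field; rewrite gt_eqF.
Qed.

End PerronSymmetric.

(** * The Frobenius-Perron character *)

Section FusionCharacter.
Variables (R : fusionRing) (K : realType).
Implicit Types (x y : R) (i j k : fr_index R) (v : fr_index R -> K).

Definition fr_ext v x : K := \sum_i (fr_coef x i)%:~R * v i.

Lemma fr_extD v x y : fr_ext v (x + y) = fr_ext v x + fr_ext v y.
Proof.
by rewrite -big_split /=; apply: eq_bigr => i _; rewrite fr_coefD intrD mulrDl.
Qed.

Lemma fr_extMz v x (n : int) : fr_ext v (x *~ n) = n%:~R * fr_ext v x.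
Proof.
by rewrite mulr_sumr; apply: eq_bigr => i _; rewrite fr_coefMz intrM mulrCA mulrA.
Qed.

Lemma fr_ext0 v : fr_ext v 0 = 0.
Proof. by rewrite -(mulr0z (0 : R)) fr_extMz mul0r. Qed.

Lemma fr_ext_sum v (I : Type) (r : seq I) (P : pred I) (F : I -> R) :
  fr_ext v (\sum_(a <- r | P a) F a) = \sum_(a <- r | P a) fr_ext v (F a).
Proof. exact: (big_morph _ (fr_extD v) (fr_ext0 v)). Qed.

Lemma fr_ext_basis v j : fr_ext v (fr_basis j) = v j.
Proof.
rewrite /fr_ext (bigD1 j) //= fr_coef_basis eqxx mul1r big1 ?addr0 // => i /negPf ij.
by rewrite fr_coef_basis ij mul0r.
Qed.

Lemma fr_nnegM x y : fr_nneg x -> fr_nneg y -> fr_nneg (x * y).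
Proof.
move=> x0 y0 i; rewrite -[x]fr_coefK -[y]fr_coefK mulr_suml fr_coef_sum.
apply: sumr_ge0 => j _; rewrite mulr_sumr fr_coef_sum; apply: sumr_ge0 => k _.
by rewrite mulrzAl mulrzAr !fr_coefMz !mulr_ge0 ?fr_mul_ge0.
Qed.

Lemma fr_nneg_basis j : fr_nneg (fr_basis j : R).
Proof. by move=> i; rewrite fr_coef_basis; case: eqP. Qed.

Lemma fr_star_sum_basis : fr_star (\sum_k fr_basis k : R) = \sum_k fr_basis k.
Proof.
rewrite /fr_star [RHS](reindex_inj (inv_inj (@fr_dualK R))); apply: eq_bigr => i _.
rewrite fr_coef_sum (bigD1 i) //= fr_coef_basis eqxx big1 // => j ji.
by rewrite fr_coef_basis eq_sym (negPf ji).
Qed.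

(** The product [fr_basis (fr_dual j) * fr_basis i] is non-zero, hence contains some [fr_basis k].
    The summand with index [fr_dual k] then contributes a positive coefficient, and the other
    summands cannot cancel it. *)
Lemma fr_coef_sum_basis_gt0 i j : 0 < fr_coef (fr_basis i * \sum_k fr_basis k) j.
Proof.
have /eqP nz := fr_mul_neq0 (fr_dual j) i.
have [k ck] : exists k, fr_coef (fr_basis (fr_dual j) * fr_basis i) k != 0.
  apply/existsP; apply: contra_notT nz => /existsPn c0.
  rewrite -[LHS]fr_coefK big1 // => k _.
  by have := c0 k; rewrite negbK => /eqP ->; rewrite mulr0z.
rewrite -fr_coef0_dual mulrA mulr_sumr fr_coef_sum (bigD1 (fr_dual k)) //=.
have coefk : fr_coef (fr_basis (fr_dual j) * fr_basis i * fr_basis (fr_dual k)) ord0 =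
    fr_coef (fr_basis (fr_dual j) * fr_basis i) k.
  by rewrite fr_coef0C fr_coef0_dual.
rewrite coefk ltr_wpDr ?lt_def ?ck ?fr_mul_ge0 //.
apply: sumr_ge0 => l _.
by apply: fr_nnegM; [apply: fr_nnegM|]; exact: fr_nneg_basis.
Qed.

(* Left multiplications commute with right multiplication by the sum of the
   basis, so they preserve its Perron eigenline. *)
Lemma fr_character : exists d, [/\ forall i, 0 < d i, d ord0 = 1 &
  forall x y, fr_ext d (x * y) = fr_ext d x * fr_ext d y].
Proof.
pose X : R := \sum_k fr_basis k.
pose A i j : K := (fr_coef (fr_basis i * X) j)%:~R.
have A_sym i j : A i j = A j i.
  by rewrite /A fr_coef_mul_star fr_star_sum_basis.
have A_gt0 i j : 0 < A i j by rewrite ltr0z fr_coef_sum_basis_gt0.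
have [l [v [v0 Av uniq_v]]] := perron_symmetric A_sym A_gt0.
have vX y : fr_ext v (y * X) = l * fr_ext v y.
  rewrite -[y]fr_coefK mulr_suml !fr_ext_sum mulr_sumr; apply: eq_bigr => i _.
  by rewrite mulrzAl !fr_extMz mulrCA fr_ext_basis -Av.
(* Composing [fr_ext v] with left multiplication by [fr_basis j] gives another eigenvector for [l],
   hence a multiple of [v]. *)
have scal j : exists c, forall y, fr_ext v (fr_basis j * y) = c * fr_ext v y.
  have [|c cE] := uniq_v (fun i => fr_ext v (fr_basis j * fr_basis i)).
    move=> i; rewrite -vX -mulrA -[fr_basis i * X]fr_coefK mulr_sumr fr_ext_sum.
    by apply: eq_bigr => k _; rewrite mulrzAr fr_extMz.
  exists c => y; rewrite -[y]fr_coefK mulr_sumr !fr_ext_sum mulr_sumr.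
  apply: eq_bigr => i _.
  by rewrite mulrzAr !fr_extMz mulrCA fr_ext_basis cE.
have v00 := v0 ord0; have v0n : v ord0 != 0 by rewrite gt_eqF.
(* With value 1 at the unit, evaluation at 1 identifies the scalar of [scal] with [d j]. *)
pose d i := v i / v ord0.
have dE x : fr_ext d x = fr_ext v x / v ord0.
  by rewrite mulr_suml; apply: eq_bigr => i _; rewrite mulrA.
have dM j y : fr_ext v (fr_basis j * y) = d j * fr_ext v y.
  have [c cE] := scal j; rewrite cE; congr (_ * _).
  have := cE 1; rewrite mulr1 fr_ext_basis -(@fr_basis1 R) fr_ext_basis => vj.
  by rewrite /d vj mulfK.
exists d; split=> [i||x y]; first by rewrite divr_gt0.
  by rewrite /d divff.
rewrite !dE mulrA; congr (_ / _); rewrite -dE.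
rewrite -{1}[x]fr_coefK mulr_suml fr_ext_sum mulr_suml; apply: eq_bigr => i _.
by rewrite mulrzAl fr_extMz dM mulrA.
Qed.

(** Multiplicativity makes the column [d] an eigenvector of [fr_mulmx K j] for [d j]. Pairing the
    absolute values of any row eigenvector with this positive column bounds its non-negative
    eigenvalue by [d j], so the supremum is [d j]. *)
Lemma FPdim_character d : (forall i, 0 < d i) ->
  (forall x y, fr_ext d (x * y) = fr_ext d x * fr_ext d y) ->
  @FPdim_basis R K = d.
Proof.
move=> d0 dM; apply/funext => j; rewrite /FPdim_basis; set E := [set _ | _].
have NE k : \sum_l fr_mulmx K j k l * d l = d j * d k.
  rewrite -[d j]fr_ext_basis -[d k]fr_ext_basis -dM.
  by apply: eq_bigr => l _; rewrite mxE.
have Ed : E (d j).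
  split; first exact: ltW.
  rewrite /= /eigenvalue /eigenspace kermx_eq0 row_free_unit.
  apply/negP => U; suff /colP/(_ ord0) : \col_k d k = 0.
    by rewrite !mxE => /eqP; rewrite gt_eqF.
  rewrite -[LHS](mulKmx U) (_ : _ *m \col_k d k = 0) ?mulmx0 //.
  apply/colP => k; rewrite mulmxBl mul_scalar_mx !mxE -NE.
  by apply/eqP; rewrite subr_eq0; apply/eqP; apply: eq_bigr => l _; rewrite !mxE.
have Eub : ubound E (d j).
  move=> a [a0 /eigenvalueP[u uN un0]].
  pose s := \sum_k `|u ord0 k| * d k.
  have s0 : 0 < s.
    rewrite lt_def sumr_ge0 ?andbT => [|k _]; last by rewrite mulr_ge0 ?normr_ge0 // ltW.
    apply: contra un0; rewrite psumr_eq0 => [/allP s0|k _]; last first.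
      by rewrite mulr_ge0 ?normr_ge0 // ltW.
    apply/eqP/rowP => k; rewrite mxE; apply/eqP.
    by have := s0 k (mem_index_enum _); rewrite mulf_eq0 (gt_eqF (d0 k)) orbF normr_eq0.
  rewrite -(ler_pM2r s0) /s !mulr_sumr.
  under [leRHS]eq_bigr do rewrite mulrCA -NE mulr_sumr.
  rewrite exchange_big /=; apply: ler_sum => l _.
  under eq_bigr do rewrite mulrA; rewrite -mulr_suml mulrA ler_pM2r //.
  rewrite -{1}(ger0_norm a0) -normrM.
  have := congr1 (fun w : 'rV_ _ => w ord0 l) uN; rewrite !mxE => <-.
  apply: le_trans (ler_norm_sum _ _ _) _; apply: ler_sum => k _.
  by rewrite normrM mxE [X in _ * X]ger0_norm // ler0z fr_mul_ge0.
apply/eqP; rewrite eq_le; apply/andP; split.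
  by apply: ge_sup => //; exists (d j).
by apply: ub_le_sup => //; exists (d j).
Qed.

Lemma FPdim_basis_gt0 i : 0 < @FPdim_basis R K i.
Proof. by have [d [d0 _ dM]] := fr_character; rewrite (FPdim_character d0 dM). Qed.

Lemma FPdimM x y : FPdim K (x * y) = FPdim K x * FPdim K y.
Proof.
have [d [d0 _ dM]] := fr_character.
by rewrite /FPdim (FPdim_character d0 dM) -/(fr_ext d _) dM.
Qed.

Lemma FPdim_basisE j : FPdim K (fr_basis j : R) = @FPdim_basis R K j.
Proof. exact: (fr_ext_basis (@FPdim_basis R K)). Qed.

Lemma FPdim1 : FPdim K (1 : R) = 1.
Proof.
have [d [d0 d1 dM]] := fr_character.
by rewrite -(@fr_basis1 R) FPdim_basisE (FPdim_character d0 dM).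
Qed.

Lemma FPdimD x y : FPdim K (x + y) = FPdim K x + FPdim K y.
Proof. exact: fr_extD. Qed.

Lemma FPdim0 : FPdim K (0 : R) = 0.
Proof. exact: fr_ext0. Qed.

End FusionCharacter.

(** * Positive and negative roots of the unfolded group *)

Section ReducedWords.
Variables (S : finType) (M : coxeterMatrix S).
Implicit Types (u v : seq S) (s t : S).

Definition cox_reduced u := forall u', cox_equiv M u u' -> (size u <= size u')%N.

(** All relators have even length. *)
Lemma cox_equiv_odd u v : cox_equiv M u v -> odd (size u) = odd (size v).
Proof.
elim=> {u v} [u v s t k _|//|u v _ ->//|u v w _ -> _ ->//].
rewrite !size_cat !oddD; suff -> : odd (size (Defs.alternating k s t)) = false by [].
by elim: k => //= k; rewrite negbK.
Qed.

(** A relator cut in two equates the first piece with the inverse of the second; generators are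
    involutions, so inverting a word reverses it. *)
Lemma cox_equiv_alternating k s t u v :
  M s t = Some k -> Defs.alternating k s t = u ++ v -> cox_equiv M u (rev v).
Proof.
move=> Mst uv; apply: cox_trans (cox_symm (_ : cox_equiv M (u ++ v ++ rev v) u)) _.
  rewrite -[X in cox_equiv _ _ X]cats0.
  exact: cox_equiv_cat (cox_refl _ _) (cox_equiv_cat_rev _ _).
by rewrite catA -uv; exact: (cox_rel [::] (rev v) Mst).
Qed.

Lemma cox_reducedW u v w : cox_reduced (u ++ v ++ w) -> cox_reduced v.
Proof.
move=> red v' vv'; have := red _ (cox_equiv_ctx u w vv').
by rewrite !size_cat leq_add2l leq_add2r.
Qed.

Lemma cox_reduced_equiv u v : cox_equiv M u v -> (size v <= size u)%N ->
  cox_reduced u -> cox_reduced v.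
Proof.
by move=> uv vu red w vw; apply: leq_trans vu (red _ (cox_trans uv vw)).
Qed.

Lemma cox_reduced_exists u : exists2 v, cox_equiv M u v & cox_reduced v.
Proof.
have ex : exists n, `[< exists2 v, cox_equiv M u v & size v = n >].
  by exists (size u); apply/asboolP; exists u => //; exact: cox_refl.
case: (ex_minnP ex) => n /asboolP[v uv <-] vmin; exists v => // w vw.
by apply: vmin; apply/asboolP; exists w => //; exact: cox_trans uv vw.
Qed.

Lemma cox_reduced_neq s t u v : cox_reduced (u ++ s :: t :: v) -> s != t.
Proof.
move=> red; apply/negP => /eqP st; move: red; rewrite -st => red.
have := red _ (cox_rel u v (cox_diag M s)).
by rewrite !size_cat /= leq_add2l ltnNge leqnSn.
Qed.

(** Appending a letter changes the length by at most one, and parity forbids no change. If the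
    length does not grow it drops by one, and a shortest word for the product, followed by [s],
    spells [u]. *)
Lemma cox_not_reduced_rcons u s : cox_reduced u -> ~ cox_reduced (rcons u s) ->
  exists2 v, cox_equiv M (rcons v s) u & (size v).+1 = size u.
Proof.
move=> red nred; have [v uv vred] := cox_reduced_exists (rcons u s).
have ss : cox_equiv M [:: s; s] [::] := cox_rel [::] [::] (cox_diag M s).
have vu : cox_equiv M (rcons v s) u.
  rewrite -cats1; apply: cox_trans (cox_equiv_cat (cox_symm uv) (cox_refl _ _)) _.
  by rewrite -cats1 -catA -[X in cox_equiv _ _ X]cats0; exact: cox_equiv_cat (cox_refl _ _) ss.
exists v => //.
have le1 : (size u <= (size v).+1)%N.
  by rewrite -[(size v).+1](size_rcons v s); exact: red (cox_symm vu).
have := cox_equiv_odd vu; rewrite size_rcons.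
have := vred _ (cox_symm uv); rewrite size_rcons => le2.
have neq : size v <> (size u).+1.
  by move=> e; apply: nred; apply: cox_reduced_equiv (cox_symm uv) _ vred; rewrite size_rcons e.
by move: le1 le2 neq; move: (size u) (size v) => m n ? ? ? /=; case: (ltngtP n.+1 m); lia.
Qed.

End ReducedWords.

(** * Signs of the coordinates of roots *)

Section UnfoldedRoots.
Variables (K : realType) (S : finType) (M : coxeterMatrix S) (R : fusionRing).
Variable L : realisation K M R.

Notation unf_index := (fr_index R * S)%type.
Notation lattice := (fr_lattice S R).
Notation refl := (unf_refl L).
Notation form p v := (unf_form L (unf_root p) v).
Implicit Types (p q : unf_index) (u v : lattice) (d : seq unf_index).

Lemma unf_coordN p v : unf_coord p (- v) = - unf_coord p v.
Proof. by rewrite -[- v]mulrN1z unf_coordMz mulrN1. Qed.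

Lemma unf_coord0 p : unf_coord p (0 : lattice) = 0.
Proof. by rewrite -(mulr0z (0 : lattice)) unf_coordMz mulr0. Qed.

Lemma unf_coord_inj u v : (forall p, unf_coord p u = unf_coord p v) -> u = v.
Proof.
move=> uv; apply/ffunP => s; rewrite -[u s]fr_coefK -[v s]fr_coefK.
by apply: eq_bigr => i _; congr (_ *~ _); exact: (uv (i, s)).
Qed.

Lemma unf_form_rootN p v : form p (- v) = - form p v.
Proof. by rewrite -[- v]mulrN1z unf_form_rootMz mulrN1. Qed.

Lemma unf_reflD p u v : refl p (u + v) = refl p u + refl p v.
Proof. by rewrite /unf_refl unf_form_rootD mulrzDr opprD addrACA. Qed.

Lemma unf_reflN p v : refl p (- v) = - refl p v.
Proof. by rewrite /unf_refl unf_form_rootN mulrNz opprD. Qed.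

Lemma unf_refl_root p : refl p (unf_root p) = - unf_root p.
Proof.
rewrite /unf_refl unf_form_roots /unf_entry eqxx.
by rewrite -[2]/(1 + 1 : int) mulrzDr mulr1z opprD addrA subrr sub0r.
Qed.

Lemma unf_reflMz p v n : refl p (v *~ n) = refl p v *~ n.
Proof. by rewrite /unf_refl unf_form_rootMz mulrzA mulrzBl. Qed.

Lemma unf_reflK p : involutive (refl p).
Proof. exact: unf_refl_rel (unf_label_diag L p). Qed.

Lemma unf_coord_refl q p v :
  unf_coord q (refl p v) = unf_coord q v - (q == p)%:R * form p v.
Proof. by rewrite unf_coordD unf_coordN unf_coordMz unf_coord_root. Qed.

Lemma unf_entry_le0 p q : p != q -> unf_entry L p q <= 0.
Proof.
move=> /negPf pq; rewrite /unf_entry pq; case: (eqVneq p.2 q.2) => // st.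
rewrite -oppr_ge0 -mulrN1 -fr_coefMz mulrN1z -mulrN.
by apply: fr_nnegM; [exact: fr_nneg_basis|exact: rl_form_nneg].
Qed.

Definition unf_pos v := forall p, 0 <= unf_coord p v.

Lemma unf_pos_root p : unf_pos (unf_root p).
Proof. by move=> q; rewrite unf_coord_root; case: eqP. Qed.

Lemma unf_posD u v : unf_pos u -> unf_pos v -> unf_pos (u + v).
Proof. by move=> u0 v0 p; rewrite unf_coordD addr_ge0. Qed.

Lemma unf_posMz v n : 0 <= n -> unf_pos v -> unf_pos (v *~ n).
Proof. by move=> n0 v0 p; rewrite unf_coordMz mulr_ge0. Qed.

Lemma unf_wordD d u v :
  word_act refl d (u + v) = word_act refl d u + word_act refl d v.
Proof. by elim: d => //= p d ->; rewrite unf_reflD. Qed.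

Lemma unf_wordMz d v n : word_act refl d (v *~ n) = word_act refl d v *~ n.
Proof. by elim: d => //= p d ->; rewrite unf_reflMz. Qed.

Lemma unf_wordN d v : word_act refl d (- v) = - word_act refl d v.
Proof. by elim: d => //= p d ->; rewrite unf_reflN. Qed.

Lemma word_act_cat d d' v :
  word_act refl (d ++ d') v = word_act refl d (word_act refl d' v).
Proof. by rewrite /word_act foldr_cat. Qed.

Let refl_l p q (x y : int) : p != q ->
  refl p (unf_root p *~ x + unf_root q *~ y) =
  unf_root p *~ (- x - unf_entry L p q * y) + unf_root q *~ y.
Proof.
move=> pq; rewrite {1}/unf_refl unf_form_rootD !unf_form_rootMz !unf_form_roots.
rewrite {1}/unf_entry eqxx addrAC -mulrzBr; congr (_ *~ _ + _); ring.
Qed.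

Let refl_r p q (x y : int) : p != q ->
  refl q (unf_root p *~ x + unf_root q *~ y) =
  unf_root p *~ x + unf_root q *~ (- y - unf_entry L p q * x).
Proof. by move=> pq; rewrite addrC refl_l 1?eq_sym // addrC unf_entry_sym. Qed.

Notation reduced := (cox_reduced (unf_matrix L)).

(** Rank-two case of the positivity of roots. Only the labels 2, 3 and infinity occur: the finite
    ones leave a few reduced words to compute, the infinite one is an induction comparing the two
    coordinates. *)
Lemma unf_dihedral p q d : p != q -> all (mem [:: p; q]) d ->
  reduced (rcons d p) ->
  exists x y : int, [/\ 0 <= x, 0 <= y &
    word_act refl d (unf_root p) = unf_root p *~ x + unf_root q *~ y].
Proof.
move=> pq; have qp : q != p by rewrite eq_sym.
have lab m : unf_label L p q = Some m -> unf_matrix L p q = Some m by [].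
have lab' m : unf_label L p q = Some m -> unf_matrix L q p = Some m.
  by rewrite unf_label_sym.
have last2 (d' : seq unf_index) y : reduced (rcons (rcons d' y) p) -> y \in [:: p; q] -> y = q.
  rewrite -!cats1 -catA => /cox_reduced_neq yp; rewrite !inE (negPf yp).
  by move/eqP.
have last3 (d' : seq unf_index) x y : reduced (rcons (rcons (rcons d' x) y) p) ->
    x \in [:: p; q] -> y \in [:: p; q] -> x = p /\ y = q.
  move=> red xin yin; have yq := last2 _ _ red yin; split=> //.
  move: red; rewrite yq -!cats1 -!catA /= => /cox_reduced_neq xq.
  by move: xin; rewrite !inE (negPf xq) orbF => /eqP.
have root_p : unf_root p = unf_root p *~ 1 + unf_root q *~ 0.
  by rewrite mulr0z addr0.
have [e0|e0] := eqVneq (unf_entry L p q) 0.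
  have pq2 : unf_label L p q = Some 2%N by rewrite /unf_label (negPf pq) e0.
  case/lastP: d => [|d y]; first by exists 1, 0; rewrite -root_p.
  case/lastP: d => [|d x].
    rewrite all_seq1 => yin /(last2 [::])-/(_ yin) ->.
    by exists 1, 0; rewrite /= {1}root_p refl_r // e0.
  rewrite !all_rcons => /and3P[yin xin _] red.
  have [xp yq] := last3 _ _ _ red xin yin.
  (* A longer word would end in [p], [q], [p], which the relation of order 2 shortens to [q]. *)
  move: red; rewrite xp yq -!cats1 -!catA -[_ ++ _ ++ _]cats0 -catA => /cox_reducedW/=.
  by move=> /(_ _ (cox_equiv_alternating (u := [:: p; q; p]) (v := [:: q]) (lab _ pq2) erefl)).
have [e1|e1] := eqVneq (unf_entry L p q) (-1).
  have pq3 : unf_label L p q = Some 3%N by rewrite /unf_label (negPf pq) e1.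
  case/lastP: d => [|d z]; first by exists 1, 0; rewrite -root_p.
  case/lastP: d => [|d y].
    rewrite all_seq1 => yin /(last2 [::])-/(_ yin) ->.
    by exists 1, 1; rewrite /= {1}root_p refl_r // e1.
  case/lastP: d => [|d x].
    rewrite /= andbT => /andP[yin zin] red.
    have [-> ->] := last3 [::] _ _ red yin zin.
    by exists 0, 1; rewrite /= {1}root_p refl_r // e1 refl_l // e1.
  rewrite !all_rcons => /and4P[zin yin xin _] red.
  have [yp zq] := last3 _ _ _ red yin zin.
  move: red; rewrite yp zq -!cats1 -!catA /= => red.
  have xq : x = q.
    by move: (cox_reduced_neq red) xin; rewrite !inE => /negPf -> /eqP.
  move: red; rewrite xq -[_ ++ _]cats0 -catA => /cox_reducedW/=.
  by move=> /(_ _ (cox_equiv_alternating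
    (u := [:: q; p; q; p]) (v := [:: q; p]) (lab' _ pq3) erefl)).
have em2 : unf_entry L p q <= -2 by have := unf_entry_le0 pq; lia.
move=> din red.
(* The coordinate at the first letter is kept at least as large as the other one; as the entry is at
   most -2, the next reflection then preserves signs and reverses the comparison. The default [p] of
   [head] is the letter that follows an empty [d] in [rcons d p]. *)
suff [x [y [x0 y0 xy _ _]]] : exists x y : int, [/\ 0 <= x, 0 <= y,
    word_act refl d (unf_root p) = unf_root p *~ x + unf_root q *~ y,
    (head p d = p -> y <= x) & (head p d = q -> x <= y)] by exists x, y.
elim: d din red => [_ _|r d IHd].
  exists 1, 0; split=> [//|//||//|/= e]; first exact: root_p.
  by rewrite e eqxx in pq.
rewrite /= => /andP[rin din] red.
have rneq : r != head p d by case: (d) red => [|a l]; exact: (@cox_reduced_neq _ _ _ _ [::]).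
have redd : reduced (rcons d p).
  by apply: (@cox_reducedW _ _ [:: r] _ [::]); rewrite cats0.
have [x [y [x0 y0 -> hp hq]]] := IHd din redd.
have hin : head p d \in [:: p; q] by case: (d) din => [|a l /= /andP[]//]; rewrite !inE eqxx.
move: rin rneq hin; rewrite /= !inE => /orP[]/eqP -> /negPf hd.
  rewrite eq_sym hd /= => /eqP/hq xy; rewrite refl_l //.
  exists (- x - unf_entry L p q * y), y.
  by split=> // [||e]; [nia|nia|rewrite e eqxx in pq].
rewrite [head p d == q]eq_sym hd orbF => /eqP/hp yx; rewrite refl_r //.
exists x, (- y - unf_entry L p q * x).
by split=> // [|e|]; [nia|rewrite e eqxx in qp|nia].
Qed.

(* Deodhar: factor u = v d with d the longest suffix in the dihedral subgroup of
   p and the last letter of u; then v lengthens on both dihedral generators. *)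
Lemma unf_root_pos (u : seq unf_index) p : reduced (rcons u p) ->
  unf_pos (word_act refl u (unf_root p)).
Proof.
have [n] := ubnP (size u); elim: n u p => // n IHn u p; rewrite ltnS => un.
case/lastP: u un => [|u' q] un red; first exact: unf_pos_root.
set u := rcons u' q in un red *.
have qp : q != p by move: red; rewrite /u -!cats1 -catA; exact: cox_reduced_neq.
have pq : p != q by rewrite eq_sym.
have redu : reduced u by apply: (@cox_reducedW _ _ [::] _ [:: p]); rewrite cats1.
pose fact (v d : seq unf_index) := [/\ all (mem [:: p; q]) d, cox_equiv (unf_matrix L) u (v ++ d)
  & (size v + size d)%N = size u].
have ex : exists k, `[< exists v d : seq unf_index, fact v d /\ size v = k >].
  exists (size u'); apply/asboolP; exists u', [:: q]; split=> //; split=> //.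
  - by rewrite /= !inE eqxx orbT.
  - by rewrite cats1; exact: cox_refl.
  - by rewrite size_rcons addn1.
case: (ex_minnP ex) => k /asboolP[v [d [[din uvd sz] vk]]] kmin.
(* Cutting off the last letter [q] is one admissible factorisation, so the minimal [v] is short
   enough for the induction hypothesis. *)
have vn : (size v < n)%N.
  apply: leq_trans un; rewrite size_rcons ltnS vk; apply: kmin; apply/asboolP.
  exists u', [:: q]; split=> //; split=> //.
  - by rewrite /= !inE eqxx orbT.
  - by rewrite cats1; exact: cox_refl.
  - by rewrite size_rcons addn1.
have redvd : reduced (v ++ d).
  by apply: cox_reduced_equiv uvd _ redu; rewrite size_cat sz.
have redv : reduced v by exact: (@cox_reducedW _ _ [::] _ d).
(* If [r] shortened [v], it could be moved from the end of [v] to the front of [d], against the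
   minimality of [k]. *)
have redvr r : r \in [:: p; q] -> reduced (rcons v r).
  move=> rin; apply: contrapT => /(cox_not_reduced_rcons redv)[v' vv' szv'].
  have : (k <= size v')%N.
    apply: kmin; apply/asboolP; exists v', (r :: d); split=> //; split.
    - by rewrite /= rin.
    - apply: cox_trans uvd _; rewrite -cat_rcons.
      exact: cox_equiv_cat (cox_symm vv') (cox_refl _ _).
    - by rewrite -sz -szv' /= addSnnS.
  by rewrite -vk -szv' ltnn.
have redd : reduced (rcons d p).
  apply: (@cox_reducedW _ _ v _ [::]); rewrite cats0 -rcons_cat.
  have le : (size (rcons (v ++ d) p) <= size (rcons u p))%N.
    by rewrite 2!size_rcons size_cat sz.
  apply: cox_reduced_equiv _ le red.
  by rewrite -!cats1; exact: cox_equiv_cat uvd (cox_refl _ _).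
have [x [y [x0 y0 dE]]] := unf_dihedral pq din redd.
rewrite (word_act_equiv (@unf_refl_rel _ _ _ _ L) uvd) word_act_cat dE.
rewrite unf_wordD !unf_wordMz.
have pos r : r \in [:: p; q] -> unf_pos (word_act refl v (unf_root r)).
  by move=> /redvr; exact: IHn.
by apply: unf_posD; apply: unf_posMz => //; apply: pos; rewrite !inE eqxx ?orbT.
Qed.

Definition unf_is_root v := exists d p, v = word_act refl d (unf_root p).

(** Take [d] reduced. If appending [p] keeps it reduced, [unf_root_pos] applies; otherwise [d] has a
    reduced expression ending in [p], and that last reflection negates the simple root. *)
Lemma unf_is_root_sign v : unf_is_root v -> unf_pos v \/ unf_pos (- v).
Proof.
move=> [d0 [p ->]]; have [d dd red] := cox_reduced_exists (unf_matrix L) d0.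
rewrite (word_act_equiv (@unf_refl_rel _ _ _ _ L) dd).
have [redp|nredp] := pselect (reduced (rcons d p)).
  by left; exact: unf_root_pos.
have [d' d'd szd'] := cox_not_reduced_rcons red nredp.
right; rewrite -(word_act_equiv (@unf_refl_rel _ _ _ _ L) d'd).
rewrite -cats1 word_act_cat /= unf_refl_root unf_wordN opprK.
apply: unf_root_pos; apply: cox_reduced_equiv (cox_symm d'd) _ red.
by rewrite size_rcons szd'.
Qed.

End UnfoldedRoots.
(** * Chamber orbits and Tits cones *)

Section ChamberOrbit.
Variables (K : realType) (V : Type) (G : groupType) (act : G -> V -> V).
Hypothesis actP : is_action act.
Variable C : set (V -> K).
Implicit Types (Z : V -> K) (w : G).

Lemma is_actionK w v : act w^-1%g (act w v) = v.
Proof. by case: actP => act1 actM; rewrite -actM mulVg act1. Qed.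

Lemma is_actionKV w v : act w (act w^-1%g v) = v.
Proof. by case: actP => act1 actM; rewrite -actM mulgV act1. Qed.

Lemma chamber_orbitP Z : chamber_orbit act C Z <-> exists w, C (Z \o act w).
Proof.
split=> [[w _ [Z0 CZ0 <-]]|[w CZ]]; exists w.
- rewrite (_ : _ \o _ = Z0) //; apply/funext => v.
  by rewrite /dual_act /= is_actionK.
- by [].
- by exists (Z \o act w) => //; apply/funext => v; rewrite /dual_act /= is_actionKV.
Qed.

Lemma chamber_orbit_act w Z : chamber_orbit act C (Z \o act w) <-> chamber_orbit act C Z.
Proof.
case: actP => _ actM; rewrite !chamber_orbitP; split=> [[x CZ]|[x CZ]].
  exists (w * x)%g; rewrite (_ : _ \o _ = (Z \o act w) \o act x) //.
  by apply/funext => v /=; rewrite actM.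
exists (w^-1 * x)%g; rewrite (_ : _ \o _ = Z \o act x) //.
by apply/funext => v /=; rewrite actM is_actionKV.
Qed.

End ChamberOrbit.

(** * Neighbourhoods for pointwise convergence *)

Section PointwiseNeighbourhoods.
Variables (K : realType) (V : choiceType).

(** The topology is the coarsest one making all evaluations continuous, so finite intersections of
    conditions at single points form a base of neighbourhoods. *)
Lemma nbhs_ptwsP (Z : V -> K) (A : set (V -> K)) :
  nbhs (Z : {ptws V -> K}) A <->
  exists (r : seq V) (e : K), 0 < e /\ forall Z' : V -> K,
    (forall v, v \in r -> `|Z' v - Z v| < e) -> A Z'.
Proof.
have nbZ : @Filter (V -> K) (nbhs (Z : {ptws V -> K})) := nbhs_filter (Z : {ptws V -> K}).
split=> [ZA|[r [e [e0 H]]]]; last first.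
  apply: filterS (H : [set Z' : V -> K | forall v, v \in r -> `|Z' v - Z v| < e] `<=` A) _.
  elim: r {H} => [|v r IHr]; first by apply: filterE.
  have Zv : nbhs (Z : {ptws V -> K}) [set Z' : V -> K | `|Z' v - Z v| < e].
    have := @proj_continuous V (fun=> K) v Z _ (nbhsx_ballx (Z v) e e0).
    apply: (@filterS _ _ nbZ) => Z'; by rewrite /= /ball /= distrC.
  apply: (@filterS _ _ nbZ) (@filterI _ _ nbZ _ _ Zv IHr) => Z' [/= Z'v Z'r] w.
  by rewrite inE => /predU1P[->//|/Z'r].
pose B (re : seq V * K) := [set Z' : V -> K | forall v, v \in re.1 -> `|Z' v - Z v| < re.2].
pose F : set_system (V -> K) := filter_from [set re | 0 < re.2] B.
suff FZ : F --> (Z : {ptws V -> K}).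
  by have [[r e] /= e0 BA] := FZ A ZA; exists r, e; split.
have FF : Filter F.
  apply: filter_from_filter; first by exists ([::], 1) => /=.
  move=> [r e] [r' e'] /= e0 e'0; exists (r ++ r', Num.min e e').
    by rewrite /= lt_min e0.
  move=> Z' BZ; split=> v vr; have := BZ v; rewrite /= mem_cat vr ?orbT lt_min.
    by move=> /(_ isT)/andP[].
  by move=> /(_ isT)/andP[].
apply/cvg_sup => v C; rewrite nbhsE => -[B0 [[U openU <-] UZ] UC].
have /nbhs_ballP[e e0 He] : nbhs (Z v) U by exact: open_nbhs_nbhs.
exists ([:: v], e) => // Z' BZ; apply: UC; apply: He.
by rewrite /ball /= distrC BZ // inE.
Qed.

Variables (G : groupType) (act : G -> V -> V) (Theta C : set (V -> K)).

(** Unfolds the relative interior into finitely many test vectors and a tolerance, the form in which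
    cone membership is used and proved below. *)
Lemma tits_coneP (Z : V -> K) : tits_cone act Theta C Z <->
  Theta Z /\ exists (r : seq V) (e : K), 0 < e /\ forall Z', Theta Z' ->
    (forall v, v \in r -> `|Z' v - Z v| < e) -> chamber_orbit act C Z'.
Proof.
have nbE : Theta Z -> @interior (subspace (Theta : set {ptws V -> K})) (chamber_orbit act C) Z
    = nbhs (Z : {ptws V -> K}) [set Z' | Theta Z' -> chamber_orbit act C Z'].
  move=> ThZ; rewrite /interior /=.
  have := @nbhs_subspace_in {ptws V -> K} Theta Z ThZ.
  by rewrite /nbhs /= => <-.
rewrite /tits_cone; split=> [[ThZ]|[ThZ [r [e [e0 H]]]]].
  rewrite nbE // => /nbhs_ptwsP[r [e [e0 H]]].
  by split=> //; exists r, e; split=> // Z' ThZ' /H; exact.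
split=> //; rewrite nbE //; apply/nbhs_ptwsP; exists r, e; split=> // Z' ? ?.
exact: H.
Qed.

End PointwiseNeighbourhoods.

(** * Orbit of the unfolded chamber *)

Section UnfoldedChambers.
Variables (K : realType) (S : finType) (M : coxeterMatrix S) (R : fusionRing).
Variable L : realisation K M R.

Notation unf_index := (fr_index R * S)%type.
Notation lattice := (fr_lattice S R).
Notation refl := (unf_refl L).
Implicit Types (p q : unf_index) (u v : lattice) (d : seq unf_index).
Implicit Types (Z : lattice -> K).

Lemma unf_decomp v : v = \sum_p unf_root p *~ unf_coord p v.
Proof.
apply: unf_coord_inj => q.
rewrite (big_morph _ (@unf_coordD S R q) (unf_coord0 q)) (bigD1 q) //=.
rewrite unf_coordMz unf_coord_root eqxx mul1r big1 ?addr0 // => p /negPf pq.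
by rewrite unf_coordMz unf_coord_root eq_sym pq mul0r.
Qed.

Section AdditiveFunctional.
Variable Z : lattice -> K.
Hypothesis ZD : unf_dual K S R Z.

Lemma unf_dual0 : Z 0 = 0.
Proof. by apply: (addrI (Z 0)); rewrite -ZD !addr0. Qed.

Lemma unf_dualN v : Z (- v) = - Z v.
Proof. by apply: (addrI (Z v)); rewrite -ZD !subrr unf_dual0. Qed.

Lemma unf_dualMz v n : Z (v *~ n) = n%:~R * Z v.
Proof.
have ZMn m : Z (v *+ m) = m%:R * Z v.
  elim: m => [|m IHm]; first by rewrite mulr0n unf_dual0 mul0r.
  by rewrite mulrS ZD IHm -natr1 mulrDl mul1r addrC.
case: n => n; first by rewrite -!pmulrn ZMn.
by rewrite NegzE !mulrNz -!pmulrn unf_dualN ZMn mulNr.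
Qed.

Lemma unf_dual_sum (I : Type) (r : seq I) (F : I -> lattice) :
  Z (\sum_(i <- r) F i) = \sum_(i <- r) Z (F i).
Proof. exact: (big_morph _ ZD unf_dual0). Qed.

Lemma unf_dualE v : Z v = \sum_p (unf_coord p v)%:~R * Z (unf_root p).
Proof.
rewrite {1}[v]unf_decomp unf_dual_sum.
by apply: eq_bigr => p _; rewrite unf_dualMz.
Qed.

End AdditiveFunctional.

Lemma unf_dual_refl p Z : unf_dual K S R Z -> unf_dual K S R (Z \o refl p).
Proof. by move=> ZD u v; rewrite /= unf_reflD ZD. Qed.

Lemma word_act_revK d : cancel (word_act refl d) (word_act refl (rev d)).
Proof.
move=> v; rewrite -word_act_cat.
exact: (word_act_equiv (@unf_refl_rel _ _ _ _ L) (cox_equiv_rev_cat (unf_matrix L) d)).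
Qed.

Lemma unf_is_root_root p : unf_is_root L (unf_root p).
Proof. by exists [::], p. Qed.

Lemma unf_is_root_word d v : unf_is_root L v -> unf_is_root L (word_act refl d v).
Proof. by move=> [d' [p ->]]; exists (d ++ d'), p; rewrite word_act_cat. Qed.

Lemma unf_root_neq_neg p v : unf_pos v -> v <> - unf_root p.
Proof.
by move=> v0 vE; have := v0 p; rewrite vE unf_coordN unf_coord_root eqxx.
Qed.

(** The reflection alters only the coordinate at [p]. If the image were negative, all other
    coordinates of [v] would vanish, so [v] would be an integral multiple of [unf_root p]; carrying
    [v] back to a simple root shows that the factor divides 1. *)
Lemma unf_refl_pos p v : unf_is_root L v -> unf_pos v -> v <> unf_root p ->
  unf_pos (refl p v).
Proof.
move=> vroot v0 vp; case: (unf_is_root_sign (unf_is_root_word [:: p] vroot)) => // rv0.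
have c0 q : q != p -> unf_coord q v = 0.
  move=> /negPf qp; have := rv0 q; rewrite unf_coordN unf_coord_refl qp mul0r subr0.
  by rewrite oppr_ge0 => le0; apply/eqP; rewrite eq_le le0 v0.
have vE : v = unf_root p *~ unf_coord p v.
  by rewrite {1}[v]unf_decomp (bigD1 p) //= big1 ?addr0 // => q /c0 ->; rewrite mulr0z.
case: vroot => d [q vd].
have : unf_coord q (word_act refl (rev d) (unf_root p)) * unf_coord p v = 1.
  by rewrite -unf_coordMz -unf_wordMz -vE vd word_act_revK unf_coord_root eqxx.
move=> c1; case: vp; rewrite vE (_ : unf_coord p v = 1) //.
rewrite -[LHS]gez0_abs //; congr Posz.
by have /eqP := congr1 absz c1; rewrite abszM muln_eq1 => /andP[_ /eqP].
Qed.

Lemma unf_actE d v : unf_act (\pi_(coxgroup (unf_matrix L)) d) v = word_act refl d v.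
Proof. exact: (word_act_equiv (@unf_refl_rel _ _ _ _ L) (cox_reprP (unf_matrix L) d)). Qed.

Notation unf_orbit := (chamber_orbit (@unf_act K S M R L) (@unf_chamber K S R)).

Lemma unf_orbitP Z :
  unf_orbit Z <-> exists d, @unf_chamber K S R (Z \o word_act refl d).
Proof.
rewrite chamber_orbitP; last exact: unf_act_is_action.
split=> [[w CZ]|[d CZ]]; first by exists (repr w).
exists (\pi_(coxgroup (unf_matrix L)) d); rewrite (_ : _ \o _ = Z \o word_act refl d) //.
by apply/funext => v /=; rewrite unf_actE.
Qed.

Definition unf_inversion Z v := [/\ unf_is_root L v, unf_pos v & Z v < 0].

Lemma unf_inversion_refl p Z v : unf_inversion Z v -> v <> unf_root p ->
  unf_inversion (Z \o refl p) (refl p v).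
Proof.
move=> [vroot v0 Zv] vp; split; first exact: (unf_is_root_word [:: p]).
  exact: unf_refl_pos.
by rewrite /= unf_reflK.
Qed.

(** A simple reflection permutes the positive roots other than its own. Hence each letter of a word
    adds at most one inversion, and reflecting in a simple root on which [Z] is negative removes
    one. The list [r] may contain more than the inversions; the descent is on its length. *)
Lemma unf_orbit_inversions Z : unf_dual K S R Z ->
  unf_orbit Z <-> exists r : seq lattice, forall v, unf_inversion Z v -> v \in r.
Proof.
move=> ZD; rewrite unf_orbitP; split=> [[d]|[r]].
  elim: d Z {ZD} => [|p d IHd] Z [].
    move=> ZD Zge0; exists [::] => v [_ v0]; rewrite (@unf_dualE Z ZD) ltNge => /negP[].
    by apply: sumr_ge0 => -[i s] _; rewrite mulr_ge0 ?ler0z //; exact: Zge0.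
  move=> ZD Zge0; have [|r rP] := IHd (Z \o refl p); first by split.
  exists (unf_root p :: map (refl p) r) => v vinv; rewrite inE.
  case: eqVneq => //= /eqP vp; apply/mapP; exists (refl p v); last by rewrite unf_reflK.
  exact/rP/unf_inversion_refl.
have [n] := ubnP (size r); elim: n r Z ZD => // n IHn r Z ZD; rewrite ltnS => rn rP.
have [[i [s Zis]]|Zge0] := pselect (exists i s, Z (unf_root (i, s)) < 0); last first.
  exists [::]; split=> // i s; rewrite leNgt; apply/negP => Zis.
  by apply: Zge0; exists i, s.
set p := (i, s) in Zis.
have pr : unf_root p \in r.
  by apply: rP; split; [exact: unf_is_root_root|exact: unf_pos_root|].
have Zrefl v : unf_inversion (Z \o refl p) v -> v \in map (refl p) (rem (unf_root p) r).
  move=> vinv; apply/mapP; exists (refl p v); last by rewrite unf_reflK.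
  have vp : v <> unf_root p.
    move=> vp; case: vinv => _ _; rewrite vp /= unf_refl_root (unf_dualN ZD).
    by rewrite oppr_lt0 ltNge (ltW Zis).
  have [vroot v0 Zv] := vinv.
  have rvinv : unf_inversion Z (refl p v).
    split; [exact: (unf_is_root_word [:: p])|exact: unf_refl_pos|exact: Zv].
  have := rP _ rvinv; rewrite (perm_mem (perm_to_rem pr)) inE => /orP[/eqP rvp|//].
  by case: (@unf_root_neq_neg p v v0); rewrite -(unf_refl_root L) -rvp unf_reflK.
have [|d CZ] := IHn _ (Z \o refl p) (unf_dual_refl p ZD) _ Zrefl.
  by rewrite size_map size_rem //; case: (r) pr rn.
by exists (p :: d).
Qed.

End UnfoldedChambers.

(** * The group W acting through the unfolded group *)

Section RealisationAction.
Variables (K : realType) (S : finType) (M : coxeterMatrix S) (R : fusionRing).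
Variable L : realisation K M R.

Notation unf_index := (fr_index R * S)%type.
Notation lattice := (fr_lattice S R).
Notation refl := (unf_refl L).
Notation root := (simple_root R).
Implicit Types (s t : S) (v : lattice).

Lemma fr_star1 : fr_star (1 : R) = 1.
Proof. by rewrite -fr_basis1 fr_star_basis fr_dual0 fr_basis1. Qed.

(** Both sides are additive in [v], and on the roots [unf_root (j, t)] they agree by the definition
    of [unf_entry]. *)
Lemma rl_form_root_coef s v i :
  fr_coef (rl_form L (root s) v) i = unf_form L (unf_root (i, s)) v.
Proof.
rewrite unf_form_root.
have formD u w : rl_form L (root s) (u + w) = rl_form L (root s) u + rl_form L (root s) w.
  exact: rl_formDr.
have form0 : rl_form L (root s) 0 = 0.
  by apply: (addrI (rl_form L (root s) 0)); rewrite -formD !addr0.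
have formMn w m : rl_form L (root s) (w *+ m) = rl_form L (root s) w *+ m.
  by elim: m => [|m IHm]; rewrite ?mulr0n // !mulrS formD IHm.
have formN w : rl_form L (root s) (- w) = - rl_form L (root s) w.
  by apply: (addrI (rl_form L (root s) w)); rewrite -formD !subrr.
have formMz w n : rl_form L (root s) (w *~ n) = rl_form L (root s) w *~ n.
  case: n => n; first by rewrite -!pmulrn formMn.
  by rewrite NegzE !mulrNz -!pmulrn formN formMn.
rewrite {1}[v]unf_decomp (big_morph _ formD form0) fr_coef_sum.
apply: eq_bigr => -[j t] _; rewrite formMz fr_coefMz mulrC; congr (_ * _).
rewrite /unf_root /= -[root s]scale1r rl_form_simple fr_star1 mulr1.
rewrite /unf_entry /= -pair_eqE /= [i == j]eq_sym.
case: (eqVneq s t) => [<-|st]; last by rewrite andbF.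
rewrite rl_form_diag andbT mulr_natr -mulrz_nat fr_coefMz fr_coef_basis eq_sym.
by case: eqP.
Qed.

(** The roots [unf_root (i, s)] with fixed [s] are pairwise orthogonal, so their reflections
    subtract independent corrections, which add up to the one made by [s]. *)
Lemma rl_act_gen_word s v : rl_act L (cox_gen M s) v =
  word_act refl [seq (i, s) | i <- index_enum (fr_index R)] v.
Proof.
have wordE (r : seq (fr_index R)) : uniq r -> word_act refl [seq (i, s) | i <- r] v =
    v - \sum_(i <- r) unf_root (i, s) *~ unf_form L (unf_root (i, s)) v.
  elim: r => [_|i r IHr /= /andP[ir /IHr ->]]; first by rewrite big_nil subr0.
  rewrite big_cons {1}/unf_refl.
  have -> : unf_form L (unf_root (i, s)) (v -
      \sum_(j <- r) unf_root (j, s) *~ unf_form L (unf_root (j, s)) v) =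
      unf_form L (unf_root (i, s)) v.
    rewrite unf_form_rootD unf_form_rootN.
    rewrite (big_morph _ (@unf_form_rootD _ _ _ _ L (i, s)) (id1 := 0)); last first.
      by rewrite -(mulr0z (0 : lattice)) unf_form_rootMz mulr0.
    rewrite big1_seq ?subr0 // => j /andP[_ jr].
    rewrite unf_form_rootMz unf_form_roots /unf_entry /= eqxx -pair_eqE /= eqxx andbT.
    by case: eqVneq => [ij|]; [rewrite ij jr in ir|rewrite mul0r].
  by rewrite opprD [RHS]addrCA [RHS]addrC.
rewrite wordE ?index_enum_uniq // rl_act_gen; congr (_ - _).
apply: unf_coord_inj => -[j t].
rewrite (big_morph _ (@unf_coordD S R (j, t)) (unf_coord0 (j, t))).
under eq_bigr do rewrite unf_coordMz unf_coord_root -rl_form_root_coef -pair_eqE /=.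
rewrite /unf_coord !ffunE /= [_ *: _]mulr_natr -mulrz_nat fr_coefMz.
rewrite (bigD1 j) //= eqxx big1 ?addr0 => [|i /negPf ij]; first by rewrite mulrC.
by rewrite eq_sym ij mul0r.
Qed.

Lemma cox_pi_cat (u v : seq S) :
  \pi_(coxgroup M) (u ++ v) = (\pi_(coxgroup M) u * \pi_(coxgroup M) v)%g.
Proof.
apply/cox_piP; apply: cox_symm.
by apply: cox_equiv_cat; exact: cox_reprP.
Qed.

Lemma rl_act_word (w : coxgroup M) :
  exists d, rl_act L w =1 word_act refl d.
Proof.
have [act1 actM] := rl_act_action L.
rewrite -[w]reprK; elim: (repr w) => [|s u [d dE]]; first by exists [::] => v; rewrite act1.
exists ([seq (i, s) | i <- index_enum (fr_index R)] ++ d) => v.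
by rewrite (cox_pi_cat [:: s]) actM word_act_cat -rl_act_gen_word dE.
Qed.

Lemma rl_orbit_unf_orbit Z : chamber_orbit (rl_act L) (@rl_chamber K S R) Z ->
  chamber_orbit (@unf_act K S M R L) (@unf_chamber K S R) Z.
Proof.
move=> /(chamber_orbitP (rl_act_action L))[w [[ZD ZM] Z0]].
have [d dE] := rl_act_word w; apply/unf_orbitP; exists d.
rewrite (_ : _ \o _ = Z \o rl_act L w); last by apply/funext => v /=; rewrite dE.
split=> // i s; rewrite ZM mulr_ge0 ?Z0 //.
by rewrite FPdim_basisE ltW ?FPdim_basis_gt0.
Qed.

End RealisationAction.

(** * Comparison of the two arrangements *)

Lemma roots_in_seq (F : idomainType) (P : {poly F}) : P != 0 ->
  exists r : seq F, forall x, root P x -> x \in r.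
Proof.
have [n] := ubnP (size P); elim: n P => // n IHn P; rewrite ltnS => Pn P0.
have [[a /factor_theorem[Q PQ]]|noroot] := pselect (exists a, root P a); last first.
  by exists [::] => x Px; case: noroot; exists x.
have Q0 : Q != 0 by apply: contraNneq P0 => Q0; rewrite PQ Q0 mul0r.
have [|r rP] := IHn Q _ Q0.
  by apply: leq_trans Pn; rewrite PQ size_Mmonic ?monicXsubC // size_XsubC addn2.
by exists (a :: r) => x; rewrite PQ rootM root_XsubC inE => /orP[/rP ->|->]; rewrite ?orbT.
Qed.

(** A countable set has Lebesgue measure zero, a non-empty open interval does not. *)
Lemma itv_nsub_countable (K : realType) (d : K) (B : set K) : 0 < d -> countable B ->
  exists x, [/\ 0 < x, x < d & ~ B x].
Proof.
move=> d0 Bc; apply: contrapT => noex.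
have : lebesgue_measure (`]0, d[%classic : set K) = 0%E.
  apply: countable_lebesgue_measure0; apply: sub_countable Bc; apply: subset_card_le.
  move=> x; rewrite /= in_itv /= => /andP[x0 xd]; apply: contrapT => nBx.
  by apply: noex; exists x.
by rewrite lebesgue_measure_itv /= lte_fin d0 oppr0 adde0 => -[d00]; rewrite d00 ltxx in d0.
Qed.

Lemma scale_seq_lt (K : realType) (T : eqType) (f : T -> K) (r : seq T) (e : K) :
  0 < e -> exists2 d, 0 < d & forall t, t \in r -> d * `|f t| < e.
Proof.
move=> e0; pose m := \sum_(t <- r) `|f t|.
have m0 : 0 <= m by apply: sumr_ge0.
exists (e / (1 + m)) => [|t tr]; first by rewrite divr_gt0 // ltr_wpDr.
rewrite mulrAC ltr_pdivrMr ?ltr_wpDr // ltr_pM2l //.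
have : `|f t| <= m by rewrite /m (perm_big _ (perm_to_rem tr)) big_cons lerDl sumr_ge0.
by move=> h; rewrite (le_lt_trans h) // ltrDr.
Qed.

(** Substituting the image of [v] under [w] removes the inverses from the fixed-point equation. *)
Lemma dual_act_conj_fixed (K : realType) (V : Type) (G : groupType)
    (act : G -> V -> V) (actP : is_action act) (w g : G) (Z : V -> K) :
  dual_act act (w * g * w^-1)%g Z = Z <->
  forall v, Z (act w (act g v)) = Z (act w v).
Proof.
have [act1 actM] := actP.
have -> : (dual_act act (w * g * w^-1)%g Z = Z) =
    (Z \o act (w * g * w^-1)^-1%g = Z) by [].
have conjE : (w * g * w^-1)^-1%g = (w * g^-1 * w^-1)%g by rewrite !invgM invgK mulgA.
rewrite conjE; split=> [fixZ v|fixZ].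
  rewrite -[in LHS]fixZ /= !actM; congr (Z (act w _)).
  by rewrite (is_actionK actP) (is_actionK actP).
apply/funext => v; rewrite /= !actM -fixZ (is_actionKV actP).
by rewrite (is_actionKV actP).
Qed.

(** * Tits cones and reflecting hyperplanes *)

Section Realisation.
Variables (K : realType) (S : finType) (M : coxeterMatrix S) (R : fusionRing).
Variable L : realisation K M R.

Notation unf_index := (fr_index R * S)%type.
Notation lattice := (fr_lattice S R).
Notation refl := (unf_refl L).
Notation root := (simple_root R).
Notation Theta := (rl_dual K S R).
Implicit Types (s t : S) (v : lattice) (Z : lattice -> K) (w : coxgroup M).

Lemma rl_dual_act w Z : Theta Z -> Theta (Z \o rl_act L w).
Proof.
move=> [ZD ZM]; have lin := rl_act_linear L w; split=> [u v|r v] /=.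
  by have := lin 1 u v; rewrite !scale1r => ->; rewrite ZD.
have lin0 : rl_act L w 0 = 0.
  by have := lin (-1) 0 0; rewrite scaler0 addr0 scaleN1r addNr.
by have := lin r v 0; rewrite !addr0 lin0 addr0 => ->; rewrite ZM.
Qed.

Lemma unf_root_simple s : unf_root (ord0, s) = root s.
Proof. by rewrite /unf_root /= fr_basis1 scale1r. Qed.

Definition rl_functional (z : S -> K) : lattice -> K :=
  fun v => \sum_t FPdim K (v t : R) * z t.

Lemma rl_functional_dual z : Theta (rl_functional z).
Proof.
split=> [u v|r v]; rewrite /rl_functional.
  by rewrite -big_split /=; apply: eq_bigr => t _; rewrite ffunE FPdimD mulrDl.
by rewrite mulr_sumr; apply: eq_bigr => t _; rewrite ffunE FPdimM mulrA.
Qed.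

Lemma rl_functional_root z s : rl_functional z (root s) = z s.
Proof.
rewrite /rl_functional (bigD1 s) //= ffunE eqxx FPdim1 mul1r big1 ?addr0 // => t /negPf ts.
by rewrite ffunE ts FPdim0 mul0r.
Qed.

Lemma rl_dualE Z v : Theta Z -> Z v = rl_functional (Z \o root) v.
Proof.
move=> [ZD ZM]; rewrite {1}(_ : v = \sum_t v t *: root t).
  by rewrite (unf_dual_sum ZD); apply: eq_bigr => t _; rewrite ZM.
apply/ffunP => t; rewrite sum_ffunE (bigD1 t) //= !ffunE eqxx.
rewrite big1 => [|u /negPf ut]; first by rewrite addr0 [_ *: _]mulr1.
by rewrite !ffunE eq_sym ut [_ *: _]mulr0.
Qed.

Lemma rl_dual_unf_root Z p : Theta Z ->
  Z (unf_root p) = FPdim_basis K p.1 * Z (root p.2).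
Proof. by case=> _ ZM; rewrite /unf_root ZM FPdim_basisE. Qed.

Definition rl_rho := rl_functional (fun=> 1).

Lemma rl_rho_gt0 p : 0 < rl_rho (unf_root p).
Proof.
rewrite rl_dual_unf_root; last exact: rl_functional_dual.
by rewrite /rl_rho rl_functional_root mulr1 FPdim_basis_gt0.
Qed.

(** A root has coordinates of one sign, not all zero since the reversed word carries it back to a
    simple root; thus no cancellation can occur. *)
Lemma unf_is_root_neq0 Z v : unf_dual K S R Z -> (forall p, 0 < Z (unf_root p)) ->
  unf_is_root L v -> Z v != 0.
Proof.
move=> ZD Z0 vroot.
have pos_neq0 u : unf_is_root L u -> unf_pos u -> Z u != 0.
  move=> [d [p ud]] u0; rewrite (unf_dualE ZD) psumr_neq0; last first.
    by move=> q _; rewrite mulr_ge0 ?ler0z ?(ltW (Z0 q)) //; exact: u0.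
  apply/hasP; apply: contrapT => nohas.
  have uz : u = 0.
    apply: unf_coord_inj => q; rewrite unf_coord0; apply/eqP; apply: contrapT => /negP uq.
    apply: nohas; exists q; rewrite ?mem_index_enum //= mulr_gt0 // ltr0z lt_def uq; exact: u0.
  have := word_act_revK L d (unf_root p); rewrite -ud uz -(mulr0z (0 : lattice)) unf_wordMz.
  rewrite mulr0z => /(congr1 (unf_coord p)).
  by rewrite unf_coord0 unf_coord_root eqxx.
case: (unf_is_root_sign vroot) => [|vneg]; first exact: pos_neq0.
rewrite -oppr_eq0 -(unf_dualN ZD); apply: pos_neq0 => //.
case: vroot => d [p ->]; exists (rcons d p), p.
by rewrite -cats1 word_act_cat /= unf_refl_root unf_wordN.
Qed.

Lemma rl_act_simple_is_root w s : unf_is_root L (rl_act L w (root s)).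
Proof.
have [d dE] := rl_act_word L w.
by exists d, (ord0, s); rewrite dE unf_root_simple.
Qed.

(** The reflection [s] negates its simple root, so a fixed functional is equal to its own negative
    at the translated root; the reflection formula gives the converse. *)
Lemma rl_hyperplanesP H : rl_hyperplanes L H <->
  exists w s, H = [set Z | Theta Z /\ Z (rl_act L w (root s)) = 0].
Proof.
suff E w s : [set Z | Theta Z /\ dual_act (rl_act L) (w * cox_gen M s * w^-1)%g Z = Z] =
    [set Z | Theta Z /\ Z (rl_act L w (root s)) = 0].
  by split=> -[w [s ->]]; exists w, s; rewrite E.
apply/seteqP; split=> Z /= [ThZ fixZ]; split=> //.
  have [WD WM] := rl_dual_act w ThZ; have WN := unf_dualN WD; rewrite /= in WD WM WN.
  move: fixZ => /(dual_act_conj_fixed (rl_act_action L))/(_ (root s)).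
  rewrite rl_act_gen rl_form_diag scaler_nat mulr2n opprD addrA subrr sub0r WN.
  by move/eqP; rewrite -subr_eq0 -opprD oppr_eq0 -mulr2n mulrn_eq0 => /eqP.
apply/(dual_act_conj_fixed (rl_act_action L)) => v.
have [WD WM] := rl_dual_act w ThZ; have WN := unf_dualN WD; rewrite /= in WD WM WN.
by rewrite rl_act_gen WD WN WM fixZ mulr0 subr0.
Qed.

Lemma unf_hyperplanesP H : unf_hyperplanes L H <->
  exists2 v, unf_is_root L v & H = [set Z | unf_dual K S R Z /\ Z v = 0].
Proof.
have actP := unf_act_is_action L.
have E (w : coxgroup (unf_matrix L)) p : [set Z | unf_dual K S R Z /\
      dual_act (@unf_act K S M R L) (w * cox_gen (unf_matrix L) p * w^-1)%g Z = Z] =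
    [set Z | unf_dual K S R Z /\ Z (unf_act w (unf_root p)) = 0].
  apply/seteqP; split=> Z /= [ZD fixZ]; split=> //.
    move: fixZ => /(dual_act_conj_fixed actP)/(_ (unf_root p)).
    rewrite unf_act_gen unf_refl_root /unf_act /cox_act unf_wordN (unf_dualN ZD).
    by move/eqP; rewrite -subr_eq0 -opprD oppr_eq0 -mulr2n mulrn_eq0 => /eqP.
  apply/(dual_act_conj_fixed actP) => v; rewrite unf_act_gen /unf_refl.
  rewrite /unf_act /cox_act unf_wordD unf_wordN unf_wordMz ZD (unf_dualN ZD) (unf_dualMz ZD).
  by move: fixZ; rewrite /unf_act /cox_act => ->; rewrite mulr0 subr0.
split=> [[w [p ->]]|[v [d [p vd]] ->]].
  by rewrite E; exists (unf_act w (unf_root p)) => //; exists (repr w), p.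
by exists (\pi_(coxgroup (unf_matrix L)) d), p; rewrite E unf_actE -vd.
Qed.

Lemma rl_cone_act w Z : rl_cone L Z -> rl_cone L (Z \o rl_act L w).
Proof.
have actP := rl_act_action L.
move=> /tits_coneP[ThZ [r [e [e0 rP]]]]; apply/tits_coneP.
split; first exact: rl_dual_act.
exists (map (rl_act L w^-1%g) r), e; split=> // Y ThY Yr.
rewrite (_ : Y = (Y \o rl_act L w^-1%g) \o rl_act L w); last first.
  by apply/funext => v /=; rewrite (is_actionK actP).
apply/(chamber_orbit_act actP); apply: rP; first exact: rl_dual_act.
move=> v vr; have := Yr (rl_act L w^-1%g v) (map_f _ vr).
by rewrite /= (is_actionKV actP).
Qed.

Lemma rl_cone_unf_cone : rl_cone L `<=` unf_cone L.
Proof.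
move=> Z /tits_coneP[ThZ [r [e [e0 rP]]]]; have [ZD ZM] := ThZ.
have [rD rM] := rl_functional_dual (fun=> 1); rewrite -/rl_rho in rD rM.
have [d d0 dr] := scale_seq_lt rl_rho r e0.
pose Y v := Z v - d * rl_rho v.
have ThY : Theta Y.
  by split=> [u v|x v]; rewrite /Y ?ZD ?rD ?ZM ?rM; ring.
have /rl_orbit_unf_orbit : chamber_orbit (rl_act L) (@rl_chamber K S R) Y.
  apply: rP => // v /dr; rewrite /Y addrC addKr normrN normrM.
  by rewrite (gtr0_norm d0).
move=> /(unf_orbit_inversions L (rl_dual_sub ThY))[l lP].
(* The bound [d' < d * rl_rho (unf_root p)] for all [p] makes any [Z'] within [d'] of [Z] dominate
   [Y] on simple roots, hence on positive ones. Inversions of [Z'] are then inversions of [Y], which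
   are finitely many. *)
have [d' d'0 d'P] := scale_seq_lt (fun p => (rl_rho (unf_root p))^-1)
  (index_enum unf_index) d0.
apply/tits_coneP; split; first exact: rl_dual_sub.
exists (map (@unf_root S R) (index_enum unf_index)), d'; split=> // Z' Z'D Z'r.
apply/unf_orbit_inversions => //; exists l => v [vroot v0 Z'v]; apply: lP; split=> //.
apply: le_lt_trans Z'v; rewrite -subr_ge0.
have XD : unf_dual K S R (fun u => Z' u - Y u).
  by move=> u1 u2; rewrite /= Z'D (rl_dual_sub ThY); ring.
rewrite (unf_dualE XD); apply: sumr_ge0 => p _; rewrite mulr_ge0 ?ler0z //.
have rp0 := rl_rho_gt0 p.
have := d'P p (mem_index_enum _); rewrite gtr0_norm ?invr_gt0 // ltr_pdivrMr // => d'p.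
have := Z'r _ (map_f (@unf_root S R) (mem_index_enum p)).
by rewrite ltr_norml => /andP[lo _]; rewrite /Y; lra.
Qed.

(** This is a point in the relative interior of the wall of [s]: every nearby functional lies in the
    chamber or in its image under [s]. It shows that the hyperplane of [s] meets the Tits cone. *)
Lemma rl_wall_cone s : rl_cone L (rl_functional (fun t => (t != s)%:R)).
Proof.
set Z := rl_functional _; apply/tits_coneP; split; first exact: rl_functional_dual.
pose c t : K := FPdim K (rl_form L (root s) (root t)).
(* After reflection the value at the simple root of [t] exceeds [1 - e - e * |c t|], which this
   choice keeps positive. *)
have [e e0 eP] := scale_seq_lt (fun t => 1 + `|c t|) (index_enum S) (@ltr01 K).
exists (map root (index_enum S)), e; split=> // Z' ThZ' Z'r.
have [Z'D Z'M] := ThZ'.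
have near t : `|Z' (root t) - (t != s)%:R| < e.
  by have := Z'r _ (map_f root (mem_index_enum t)); rewrite /Z rl_functional_root.
have e1 t : e * (1 + `|c t|) < 1.
  by have := eP t (mem_index_enum _); rewrite [X in _ * X]ger0_norm ?addr_ge0.
apply/(chamber_orbitP (rl_act_action L)).
have [Z's|Z's] := leP 0 (Z' (root s)).
  exists 1%g; rewrite (_ : _ \o _ = Z'); last first.
    by apply/funext => v /=; case: (rl_act_action L) => ->.
  split=> // t; have [->//|ts] := eqVneq t s.
  have := near t; have := e1 t; rewrite ts ltr_norml /= => et /andP[lo _].
  have : 0 <= e * `|c t| by rewrite mulr_ge0 // ltW.
  by lra.
exists (cox_gen M s); split=> [|t]; first exact: rl_dual_act.
rewrite /= rl_act_gen Z'D (unf_dualN Z'D) Z'M.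
have [->|ts] := eqVneq t s.
  rewrite rl_form_diag mulr2n FPdimD FPdim1; lra.
have := near t; have := e1 t; rewrite ts ltr_norml /= => et /andP[lo _].
have := near s; rewrite eqxx subr0 => nears.
suff : c t * Z' (root s) <= e * `|c t| by rewrite -/(c t); lra.
apply: le_trans (ler_norm _) _; rewrite normrM mulrC.
by rewrite ler_wpM2r // ltW.
Qed.

(* If the functional v of the root were not proportional to a root of W, then a
   moment curve through Z0 inside the hyperplane of v would leave all the
   countably many hyperplanes of W, reaching a point of an open W-chamber on
   which v cannot vanish. *)
Lemma unf_root_meeting_cone Z0 v : rl_cone L Z0 -> unf_is_root L v -> Z0 v = 0 ->
  exists w s, forall Z, Theta Z -> Z v = 0 <-> Z (rl_act L w (root s)) = 0.
Proof.
move=> /tits_coneP[ThZ0 [r [e [e0 rP]]]] vroot Z0v.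
pose co (u : lattice) t : K := FPdim K (u t : R).
have dualE Z u : Theta Z -> Z u = \sum_t co u t * Z (root t) by move=> /rl_dualE->.
have rhoTh : Theta rl_rho by exact: rl_functional_dual.
have [[w [s prop]]|nprop] := pselect (exists w s, forall t t',
    co v t * co (rl_act L w (root s)) t' = co v t' * co (rl_act L w (root s)) t).
  exists w, s => Z ThZ; set q := rl_act L w (root s) in prop *.
  have [t0 vt0] : exists t, co v t != 0.
    apply: contrapT => v0; have /eqP := unf_is_root_neq0 (rl_dual_sub rhoTh) rl_rho_gt0 vroot.
    case; rewrite dualE // big1 // => t _; rewrite (_ : co v t = 0) ?mul0r //.
    by apply/eqP; apply: contrapT => /negP vt; apply: v0; exists t.
  have Zvq Y : Theta Y -> co v t0 * Y q = co q t0 * Y v.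
    move=> ThY; rewrite !(dualE Y) // !mulr_sumr; apply: eq_bigr => t _.
    by rewrite !mulrA prop [co v t * _]mulrC.
  (* The translate of [rl_rho] by [w] takes the value 1 at [q], so [q] cannot be degenerate at
     [t0]. *)
  have qt0 : co q t0 != 0.
    apply/eqP => qt0; have := Zvq _ (rl_dual_act w^-1%g rhoTh).
    rewrite qt0 mul0r /= /q (is_actionK (rl_act_action L)) /rl_rho rl_functional_root mulr1.
    by move/eqP; rewrite (negPf vt0).
  split=> Z0'; move: (Zvq Z ThZ); rewrite Z0' mulr0.
    by move/eqP; rewrite mulf_eq0 (negPf vt0) => /eqP.
  by move/esym/eqP; rewrite mulf_eq0 (negPf qt0) => /eqP.
(* The 2 by 2 minors of the coordinate vectors of [v] and [u]: as functionals of [u] they vanish at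
   [v], and they vanish together exactly when [co u] is proportional to [co v]. *)
pose D (k : 'I_#|{: S * S}|) (u : lattice) : K :=
  let: (t, t') := enum_val k in co v t * co u t' - co v t' * co u t.
have coD u u' t : co (u + u') t = co u t + co u' t by rewrite /co ffunE FPdimD.
have coM x u t : co (x *: u) t = FPdim K x * co u t by rewrite /co ffunE FPdimM.
have DTh k : Theta (D k).
  by split=> [u u'|x u]; rewrite /D; case: (enum_val k) => t t'; rewrite ?coD ?coM; ring.
have Dv k : D k v = 0 by rewrite /D; case: (enum_val k) => t t'; ring.
pose N := #|{: S * S}|.
(* Distinct positive powers keep the minors apart: at fixed [u] this polynomial in [x] has [Z0 u]
   and all minors as coefficients, so it is zero only if all minors vanish. *)
pose curve x u : K := Z0 u + \sum_(k < N) x ^+ k.+1 * D k u.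
have curveTh x : Theta (curve x).
  split=> [u u'|y u]; rewrite /curve.
    rewrite (proj1 ThZ0) addrACA -big_split /=; congr (_ + _); apply: eq_bigr => k _.
    by rewrite (proj1 (DTh k)) mulrDr.
  rewrite (proj2 ThZ0) mulrDr mulr_sumr; congr (_ + _); apply: eq_bigr => k _.
  by rewrite (proj2 (DTh k)) mulrCA.
have curve_v x : curve x v = 0.
  by rewrite /curve Z0v big1 ?addr0 // => k _; rewrite Dv mulr0.
(* Coefficient 0 is [Z0 u] and coefficient [k.+1] is [D k u]; [unlift] undoes the shift. *)
pose P u : {poly K} := \poly_(i < N.+1)
  (if unlift ord0 (inord i : 'I_N.+1) is Some k then D k u else Z0 u).
have curveP x u : curve x u = (P u).[x].
  rewrite horner_poly big_ord_recl; congr (_ + _).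
    by rewrite expr0 mulr1 (_ : inord 0 = ord0) ?unlift_none //; apply: val_inj; rewrite /= inordK.
  apply: eq_bigr => k _; rewrite mulrC; congr (_ * _).
  by rewrite (_ : inord _ = lift ord0 k) ?liftK // inord_val.
have P_neq0 w s : P (rl_act L w (root s)) != 0.
  apply/eqP => P0; apply: nprop; exists w, s => t t'; apply/eqP; rewrite -subr_eq0; apply/eqP.
  have := congr1 (fun p : {poly K} => p`_(lift ord0 (enum_rank (t, t')))) P0.
  rewrite coef_poly ltn_ord coef0 inord_val liftK /D enum_rankK //.
(* Indexing by words instead of group elements makes countability immediate. *)
pose q (i : seq S * S) := rl_act L (\pi_(coxgroup M) i.1) (root i.2).
pose bad := \bigcup_(i in [set: seq S * S]) [set x | curve x (q i) = 0].
have bad_countable : countable bad.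
  apply: bigcup_countable => // i _; apply: finite_set_countable.
  have [l lP] := roots_in_seq (P_neq0 (\pi_(coxgroup M) i.1) i.2).
  apply: sub_finite_set (finite_seq l) => x /= cx0; apply: lP.
  by rewrite /poly.root -curveP; apply/eqP.
have [d d0 dP] := scale_seq_lt (fun u => \sum_k `|D k u|) r e0.
(* Below 1 every power of [x] in the curve is at most [x], so one bound controls the whole
   perturbation. *)
have d1 : 0 < Num.min d 1 by rewrite lt_min d0 ltr01.
have [x [x0 xd nbad]] := itv_nsub_countable d1 bad_countable.
move: xd; rewrite lt_min => /andP[xd x1].
have : chamber_orbit (rl_act L) (@rl_chamber K S R) (curve x).
  apply: rP => // u /dP; apply: le_lt_trans; rewrite /curve addrC addKr.
  apply: le_trans (ler_norm_sum _ _ _) _; rewrite [X in _ * X]ger0_norm ?sumr_ge0 //.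
  rewrite mulr_sumr; apply: ler_sum => k _; rewrite normrM ler_wpM2r //.
  rewrite ger0_norm ?exprn_ge0 ?(ltW x0) // exprS; apply: le_trans _ (ltW xd).
  by rewrite ler_piMr ?(ltW x0) // exprn_ile1 ?(ltW x0) ?(ltW x1).
move=> /(chamber_orbitP (rl_act_action L))[w [YTh Y0]].
have Ygt0 s : 0 < curve x (rl_act L w (root s)).
  rewrite lt_def Y0 andbT; apply/eqP => c0; apply: nbad; exists (repr w, s) => //=.
  by rewrite /q /= reprK.
have wv : unf_is_root L (rl_act L w^-1%g v).
  by have [d' dE] := rl_act_word L w^-1%g; rewrite dE; exact: unf_is_root_word.
have Ypos p : 0 < (curve x \o rl_act L w) (unf_root p).
  by rewrite (rl_dual_unf_root _ YTh) mulr_gt0 ?FPdim_basis_gt0 //; exact: Ygt0.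
have /eqP[] := unf_is_root_neq0 (rl_dual_sub YTh) Ypos wv.
by rewrite /= (is_actionKV (rl_act_action L)) curve_v.
Qed.

(** A translate of the wall point of [s] witnesses that the unfolded hyperplane meets the cone; the
    reverse inclusion rests on [unf_root_meeting_cone]. *)
Lemma rl_hyperplanes_restrict : rl_hyperplanes L =
  [set H `&` Theta | H in [set H | unf_hyperplanes L H /\ H `&` rl_cone L !=set0]].
Proof.
apply/seteqP; split=> H.
  move=> /rl_hyperplanesP[w [s ->]].
  exists [set Z | unf_dual K S R Z /\ Z (rl_act L w (root s)) = 0]; last first.
    by apply/seteqP; split=> Z /=; [case=> -[_ ?]|case=> ThZ]; split=> //; split=> //;
      exact: rl_dual_sub.
  split.
    by apply/unf_hyperplanesP; eexists; [exact: rl_act_simple_is_root|].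
  have Zcone := rl_cone_act w^-1%g (rl_wall_cone s).
  exists (rl_functional (fun t => (t != s)%:R) \o rl_act L w^-1%g); split=> //; split.
    by case/tits_coneP: Zcone => /rl_dual_sub.
  by rewrite /= (is_actionK (rl_act_action L)) rl_functional_root eqxx.
move=> [H' [/unf_hyperplanesP[v vroot ->] [Z0 [[_ Z0v] Z0cone]]] <-].
have [w [s wsP]] := unf_root_meeting_cone Z0cone vroot Z0v.
apply/rl_hyperplanesP; exists w, s; apply/seteqP; split=> Z /=.
  by case=> -[_ Zv] ThZ; split=> //; exact/(wsP Z ThZ).
by case=> ThZ Zq; split=> //; split; [exact: rl_dual_sub|exact/(wsP Z ThZ)].
Qed.

End Realisation.

Theorem theorem1p1 (K : realType) (S : finType) (M : coxeterMatrix S)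
    (R : fusionRing) (L : realisation K M R) :
  rl_hyperplanes L =
    [set H `&` rl_dual K S R | H in
      [set H | unf_hyperplanes L H /\ H `&` rl_cone L !=set0]] /\
  rl_cone L `<=` unf_cone L /\
  rl_cone L `\` \bigcup_(H in rl_hyperplanes L) H `<=`
    unf_cone L `\` \bigcup_(H in unf_hyperplanes L) H.
Proof.
split; first exact: rl_hyperplanes_restrict.
split; first exact: rl_cone_unf_cone.
move=> Z [Zcone Znot]; split; first exact: rl_cone_unf_cone.
(* The point [Z] itself shows that [H] meets the Tits cone, so the restriction of [H] is a
   hyperplane of W through [Z]. *)
move=> [H HL HZ]; apply: Znot; exists (H `&` rl_dual K S R).
  by rewrite rl_hyperplanes_restrict; exists H => //; split=> //; exists Z.
by split=> //; case/tits_coneP: Zcone.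
Qed.
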